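(* Let $d\ge 1$ be an integer, $k>0$ and $n\ge 0$ an integer. Let $Y$ be a nonzero spherical harmonic of degree $n$ on $S^{d-1}$, and let $R:(0,\infty)\to\mathbb{C}$ be twice continuously differentiable. Define $p:\mathbb{R}^d\setminus\{0\}\to\mathbb{C}$ by $p(\mathbf r)=R(|\mathbf r|)\,Y(\mathbf r/|\mathbf r|)$. Then $p$ satisfies the homogeneous Helmholtz equation $(\Delta+k^2)p=0$ on $\mathbb{R}^d\setminus\{0\}$ if and only if there exist constants $A,B\in\mathbb{C}$ such that $$R(r)=A\,\mathrm{J}_{d,n}(kr)+B\,\mathrm{N}_{d,n}(kr)\qquad\text{for all } r>0 .$$
   Context: $\Delta=\sum_{i=1}^d\partial^2/\partial x_i^2$ is the Laplacian on $\mathbb{R}^d$. A spherical harmonic of degree $n$ on the unit sphere $S^{d-1}\subset\mathbb{R}^d$ is the restriction to $S^{d-1}$ of a complex-valued homogeneous harmonic polynomial of degree $n$ on $\mathbb{R}^d$. For $z>0$, $$\mathrm{J}_{d,n}(z):=(2\pi)^{d/2}\,\frac{J_{n+\frac d2-1}(z)}{z^{\frac d2-1}},\qquad \mathrm{N}_{d,n}(z):=(2\pi)^{d/2}\,\frac{N_{n+\frac d2-1}(z)}{z^{\frac d2-1}},$$ where $J_\nu$ and $N_\nu$ are the Bessel function of the first kind and the Neumann function (Bessel function of the second kind) of order $\nu$. *)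

(* Defs.v *)
(* Stdlib reals and Coquelicot; MathComp only for ordinals, finite functions
   and big operators. *)
From Stdlib Require Import Factorial Reals.
From Coquelicot Require Import Coquelicot.
From mathcomp Require Import ssreflect ssrfun ssrbool eqtype ssrnat seq.
From mathcomp Require Import choice fintype finfun bigop.

Set Implicit Arguments.
Unset Strict Implicit.
Unset Printing Implicit Defensive.

Local Open Scope R_scope.

(* 1 / Gamma(x), by Euler's limit formula
     Gamma(x) = lim_m m! m^x / (x (x+1) ... (x+m)).
   The reciprocal is entire: it is 0 at x = 0, -1, -2, ... *)
Definition rgamma (x : R) : R :=
  real (Lim_seq (fun m : nat =>
    (\big[Rmult/1]_(j < m.+1) (x + INR j)) / (INR (fact m) * Rpower (INR m) x))).

(* J_nu(z) = sum_m (-1)^m / (m! Gamma(m+nu+1)) (z/2)^(2m+nu), for z > 0. *)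
Definition besselJ (nu z : R) : R :=
  Rpower (z / 2) nu *
  PSeries (fun m : nat =>
    (-1) ^ m / INR (fact m) * rgamma (INR m + nu + 1)) ((z / 2) ^ 2).

Definition neumann_quotient (nu z : R) : R :=
  (besselJ nu z * cos (nu * PI) - besselJ (- nu) z) / sin (nu * PI).

(* At an integer order the quotient is 0/0 and N_nu is its limit in the order;
   [Lim] ignores the value at the point itself. *)
Definition besselN (nu z : R) : R :=
  if Req_EM_T (frac_part nu) 0
  then real (Lim (fun mu => neumann_quotient mu z) nu)
  else neumann_quotient nu z.

Definition Jdn (d n : nat) (z : R) : R :=
  Rpower (2 * PI) (INR d / 2) *
  (besselJ (INR n + INR d / 2 - 1) z / Rpower z (INR d / 2 - 1)).

Definition Ndn (d n : nat) (z : R) : R :=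
  Rpower (2 * PI) (INR d / 2) *
  (besselN (INR n + INR d / 2 - 1) z / Rpower z (INR d / 2 - 1)).

(* [C] as a real normed space: derivatives in a real variable. *)
Definition is_derive_RC (f : R -> C) (t : R) (l : C) : Prop :=
  @is_derive R_AbsRing C_R_NormedModule f t l.

Definition C2_on_pos (f : R -> C) : Prop :=
  exists f1 f2 : R -> C,
    (forall r, 0 < r -> is_derive_RC f r (f1 r)) /\
    (forall r, 0 < r -> is_derive_RC f1 r (f2 r)) /\
    (forall r, 0 < r ->
       @continuous R_UniformSpace C_R_NormedModule f2 r).

Definition pt (d : nat) : Type := 'I_d -> R.

Definition origin d : pt d := fun _ => 0.

Definition enorm d (x : pt d) : R := sqrt (\big[Rplus/0]_(i < d) (x i) ^ 2).

Definition upd d (x : pt d) (i : 'I_d) (t : R) : pt d :=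
  fun j => if j == i then t else x j.

Definition is_partial2 d (f : pt d -> C) (i : 'I_d) (x : pt d) (l : C) : Prop :=
  exists g : R -> C,
    locally (x i) (fun t => is_derive_RC (fun s => f (upd x i s)) t (g t)) /\
    is_derive_RC g (x i) l.

Definition is_laplacian d (f : pt d -> C) (x : pt d) (l : C) : Prop :=
  exists h : 'I_d -> C,
    (forall i, is_partial2 f i x (h i)) /\
    l = \big[Cplus/RtoC 0]_(i < d) h i.

(* The values of f outside R^d \ {0} are irrelevant: each slice of f through
   x <> 0 stays away from the origin near x. *)
Definition helmholtz_off_origin d (k : R) (f : pt d -> C) : Prop :=
  forall x : pt d, x <> @origin d ->
    exists l : C, is_laplacian f x l /\ (l + RtoC (k ^ 2) * f x)%C = RtoC 0.

(* A multi-index of length n has all its entries at most n, so it suffices to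
   sum over the finite type of maps from 'I_d to {0, ..., n}. *)
Definition homogeneous_polynomial d (n : nat) (P : pt d -> C) : Prop :=
  exists c : {ffun 'I_d -> 'I_n.+1} -> C, forall x : pt d,
    P x = \big[Cplus/RtoC 0]_(a : {ffun 'I_d -> 'I_n.+1} |
                               (\sum_(i < d) a i)%N == n)
            (c a * RtoC (\big[Rmult/1%R]_(i < d) (x i ^ a i)%R))%C.

Definition harmonic d (P : pt d -> C) : Prop :=
  forall x : pt d, is_laplacian P x (RtoC 0).

(* Only the values of Y on the unit sphere matter. *)
Definition spherical_harmonic d (n : nat) (Y : pt d -> C) : Prop :=
  exists P : pt d -> C,
    homogeneous_polynomial n P /\ harmonic P /\
    (forall x : pt d, enorm x = 1 -> Y x = P x).

Definition nonzero_on_sphere d (Y : pt d -> C) : Prop :=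
  exists x : pt d, enorm x = 1 /\ Y x <> RtoC 0.

Definition radial_times_angular d (Rad : R -> C) (Y : pt d -> C) : pt d -> C :=
  fun x => (Rad (enorm x) * Y (fun i => (x i / enorm x)%R))%C.

(* Main.v *)
Require Import Defs.
From HB Require Import structures.
From Stdlib Require Import FunctionalExtensionality Factorial Reals Lra Lia.
From Coquelicot Require Import Coquelicot.
From mathcomp Require Import ssreflect ssrfun ssrbool eqtype ssrnat seq.
From mathcomp Require Import choice fintype finfun bigop.

(** Write Y as the restriction of a homogeneous harmonic polynomial P.  With
    t = (k r / 2)^2 and R(r) = r^n g(t), the function p is g((k/2)^2 |x|^2) P(x),
    and by Euler's identity and the harmonicity of P the Helmholtz equation
    becomes t g'' + (nu + 1) g' + g = 0 with nu = n + d/2 - 1.  One solution is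
    the entire function C_nu with J_nu(z) = (z/2)^nu C_nu(z^2/4); another one,
    w, satisfies N_nu(z) = (z/2)^nu w(z^2/4).  Since t^(nu+1) times a Wronskian
    is constant, C_nu and w span all solutions once their Wronskian is nonzero
    somewhere, which is read off at t = 0.
      For d odd, w is a multiple of t^(-nu) C_(-nu).  For d even, nu is an
    integer m and w combines ln t C_m with the derivatives of C_mu in the order
    mu at m and -m.  These exist because 1/Gamma has a second-order expansion at
    every integer, with a remainder that is uniform along a + N: Euler's limit
    gives it at 1, and the recurrence of Gamma carries it to the other
    integers. *)

Local Open Scope R_scope.

(** * The reciprocal Gamma function *)

(** The obstacle is the Neumann function of integer order, a limit in the order of a quotient of
    power series. L'Hospital's rule asks for [clifford mu t] to be differentiated in mu term by
    term, while 1/Gamma is given only by Euler's limit. Hence the explicit second-order bounds: with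
    a single constant K for all the points a + j, the error of the j-th term is at most K h^2 |t|^j
    / j!, and these errors sum to K h^2 exp |t|. Since 1/Gamma has no poles, the same bounds are
    available at order -m, where arguments of Gamma may be poles. In the variable t = z^2/4 all
    factors other than ln t and powers of t are entire. In a Wronskian the logarithms cancel, so
    t^(nu+1) times it extends continuously to t = 0, where leading coefficients give its value. For
    integer nu > 0 this value is nonzero because the zeros of 1/Gamma are simple. *)

Fact Rmult_monoid_assoc : associative Rmult.
Proof. by move=> x y z; ring. Qed.

HB.instance Definition _ := Monoid.isComLaw.Build R 1 Rmult
  Rmult_monoid_assoc Rmult_comm Rmult_1_l.

Fact Rplus_monoid_assoc : associative Rplus.
Proof. by move=> x y z; ring. Qed.

HB.instance Definition _ := Monoid.isComLaw.Build R 0 Rplus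
  Rplus_monoid_assoc Rplus_comm Rplus_0_l.

HB.instance Definition _ := Monoid.isComLaw.Build C (RtoC 0) Cplus
  Cplus_assoc Cplus_comm Cplus_0_l.

(** The inequality [1 + x <= exp x] at ln (1 + y) and at its opposite encloses ln (1 + y) between 1
    - 1/(1 + y) and y. The gap is y^2/(1 + y), and 1 + y >= 1/2 gives the factor 2. *)
Lemma ln_1p_sub_bound y : -1/2 <= y -> Rabs (ln (1 + y) - y) <= 2 * y ^ 2.
Proof.
move=> hy.
have h1 : ln (1 + y) <= y.
  have := exp_ineq1_le (ln (1 + y)); rewrite exp_ln; lra.
have h2 : 1 - / (1 + y) <= ln (1 + y).
  have := exp_ineq1_le (- ln (1 + y)).
  rewrite exp_Ropp exp_ln; lra.
have h3 : y - (1 - / (1 + y)) <= 2 * y ^ 2.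
  have -> : y - (1 - / (1 + y)) = y ^ 2 * / (1 + y) by field; lra.
  have h4 : / (1 + y) <= 2.
    by rewrite -(Rinv_inv 2); apply: Rinv_le_contravar; lra.
  by have := pow2_ge_0 y; nra.
apply: Rabs_le; split; lra.
Qed.

Lemma ex_series_inv_sq : ex_series (fun j => / (INR j + 1) ^ 2).
Proof.
suff [l hl] : ex_finite_lim_seq (sum_n (fun j => / (INR j + 1) ^ 2)).
  by exists l.
apply: (ex_finite_lim_seq_incr _ 2) => n.
  rewrite sum_Sn /plus /=.
  have : 0 < / ((INR n.+1 + 1) * ((INR n.+1 + 1) * 1)).
    apply: Rinv_0_lt_compat; have := pos_INR n.+1; nra.
  by rewrite -/(INR n.+1); lra.
(* Telescoping bound: 1/(n+2)^2 <= 1/(n+1) - 1/(n+2). *)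
apply: (Rle_trans _ (2 - / (INR n + 1))); last first.
  have : 0 < / (INR n + 1); last by lra.
  by apply: Rinv_0_lt_compat; have := pos_INR n; lra.
elim: n => [|n IHn]; first by rewrite sum_O /=; lra.
rewrite sum_Sn /plus.
have h0 := pos_INR n.
apply: (Rle_trans _ (2 - / (INR n + 1) + / (INR n.+1 + 1) ^ 2)).
  by apply: Rplus_le_compat_r; exact: IHn.
rewrite S_INR.
have -> : / (INR n + 1) = / (INR n + 1 + 1) + / ((INR n + 1) * (INR n + 1 + 1)).
  by field; lra.
suff : / (INR n + 1 + 1) ^ 2 <= / ((INR n + 1) * (INR n + 1 + 1)) by lra.
by apply: Rinv_le_contravar; nra.
Qed.

(** Logarithm of a factor (1 + h/(j+1)) exp(-h/(j+1)) of the Weierstrass product for 1/Gamma(1 +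
    h). *)
Definition log_factor (h : R) (j : nat) : R :=
  ln (1 + h / (INR j + 1)) - h / (INR j + 1).

Lemma log_factor_bound h j : -1/2 <= h ->
  Rabs (log_factor h j) <= 2 * h ^ 2 * / (INR j + 1) ^ 2.
Proof.
move=> hh; have hj := pos_INR j.
have -> : 2 * h ^ 2 * / (INR j + 1) ^ 2 = 2 * (h / (INR j + 1)) ^ 2 by field; lra.
apply: ln_1p_sub_bound.
apply: (Rmult_le_reg_r (INR j + 1)); first lra.
by rewrite /Rdiv (Rmult_assoc h) Rinv_l; lra.
Qed.

Lemma ex_series_log_factor h : -1/2 <= h -> ex_series (log_factor h).
Proof.
move=> hh; apply: (ex_series_le _ (fun j => 2 * h ^ 2 * / (INR j + 1) ^ 2)).
  by move=> j; apply: log_factor_bound.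
by apply: (ex_series_scal (2 * h ^ 2) (fun j => / (INR j + 1) ^ 2) ex_series_inv_sq).
Qed.

Lemma Series_log_factor_bound : exists K, 0 <= K /\
  forall h, -1/2 <= h -> Rabs (Series (log_factor h)) <= K * h ^ 2.
Proof.
exists (2 * Series (fun j => / (INR j + 1) ^ 2)); split.
  have h0 : 0 <= Series (fun j => / (INR j + 1) ^ 2).
    rewrite -(Rmult_0_l (Series (fun j => / (INR j + 1) ^ 2))) -Series_scal_l.
    apply: Series_le ex_series_inv_sq => j.
    have : 0 < / (INR j + 1) ^ 2 by apply: Rinv_0_lt_compat; have := pos_INR j; nra.
    by lra.
  by lra.
move=> h hh.
have e := ex_series_scal (2 * h ^ 2) (fun j => / (INR j + 1) ^ 2) ex_series_inv_sq.
have e2 : ex_series (fun j => Rabs (log_factor h j)).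
  apply: ex_series_le e => j; rewrite /norm /= /abs /= Rabs_Rabsolu.
  exact: log_factor_bound.
apply: Rle_trans (Series_Rabs _ e2) _.
have -> : 2 * Series (fun j => / (INR j + 1) ^ 2) * h ^ 2
  = Series (fun j => 2 * h ^ 2 * / (INR j + 1) ^ 2) by rewrite Series_scal_l; ring.
apply: Series_le e => j; split; [exact: Rabs_pos | exact: log_factor_bound].
Qed.

Definition rgamma_seq (x : R) (m : nat) : R :=
  (\big[Rmult/1]_(j < m.+1) (x + INR j)) / (INR (fact m) * Rpower (INR m) x).

Lemma rgammaE x l : is_lim_seq (rgamma_seq x) (Rbar.Finite l) -> rgamma x = l.
Proof. by move=> h; rewrite /rgamma (is_lim_seq_unique _ _ h). Qed.

Lemma INR_fact_pos m : 0 < INR (fact m).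
Proof. exact: INR_fact_lt_0. Qed.

(** The sum of [log_factor 1] up to m is ln (m + 2) minus a harmonic sum. Subtracting h times it
    cancels the harmonic sum in the sum of [log_factor h], and the powers of m that remain combine
    into two ratios tending to 1. *)
Lemma rgamma_seq_1p h m : -1/2 <= h -> (0 < m)%N ->
  rgamma_seq (1 + h) m = exp (sum_n (log_factor h) m - h * sum_n (log_factor 1) m
     + h * ln ((INR m + 2) / INR m) + ln ((INR m + 1) / INR m)).
Proof.
move=> hh hm.
have hprod : forall m, \big[Rmult/1]_(j < m.+1) (1 + h + INR j) =
   INR (fact m.+1) * exp (sum_n (log_factor h) m - h * sum_n (log_factor 1) m
     + h * ln (INR m + 2)).
  clear m hm; elim=> [|m IHm].
    rewrite big_ord_recr big_ord0 /= !sum_O /log_factor /=.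
    replace (1 + 1 / (0 + 1)) with 2 by field.
    replace (1 + h / (0 + 1)) with (1 + h) by field.
    replace (0 + 2) with 2 by ring.
    replace (ln (1 + h) - h / (0 + 1) - h * (ln 2 - 1 / (0 + 1)) + h * ln 2)
      with (ln (1 + h)) by field.
    by rewrite exp_ln; lra.
  rewrite big_ord_recr IHm [nat_of_ord _]/= !sum_Sn /plus [AbelianMonoid.plus _]/=.
  have hm := pos_INR m.
  rewrite (fact_simpl m.+1) mult_INR (S_INR m).
  have -> : sum_n (log_factor h) m + log_factor h m.+1 -
     h * (sum_n (log_factor 1) m + log_factor 1 m.+1) + h * ln (INR m + 1 + 2)
    = (sum_n (log_factor h) m - h * sum_n (log_factor 1) m + h * ln (INR m + 2))
      + ln (1 + h / (INR m + 2)).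
    rewrite /log_factor S_INR.
    have -> : INR m + 1 + 1 = INR m + 2 by ring.
    have -> : 1 + 1 / (INR m + 2) = (INR m + 1 + 2) / (INR m + 2) by field; lra.
    by rewrite ln_div; lra.
  rewrite (exp_plus _ (ln (1 + h / (INR m + 2)))) exp_ln; last first.
    apply: (Rmult_lt_reg_r (INR m + 2)); first lra.
    rewrite Rmult_0_l Rmult_plus_distr_r /Rdiv (Rmult_assoc h) Rinv_l; lra.
  by rewrite /= -/(INR m.+2) !S_INR; field; lra.
rewrite /rgamma_seq hprod.
have hm1 : 1 <= INR m by apply: (le_INR 1); apply/leP.
rewrite /Rpower !ln_div; try lra.
replace (sum_n (log_factor h) m - h * sum_n (log_factor 1) m +
   h * (ln (INR m + 2) - ln (INR m)) + (ln (INR m + 1) - ln (INR m)))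
  with ((sum_n (log_factor h) m - h * sum_n (log_factor 1) m + h * ln (INR m + 2))
    + (ln (INR m + 1) + - ((1 + h) * ln (INR m)))) by ring.
rewrite (exp_plus (_ + h * ln (INR m + 2))) (exp_plus (ln _)) exp_Ropp exp_ln; last lra.
rewrite fact_simpl mult_INR S_INR.
have := exp_pos ((1 + h) * ln (INR m)); have := INR_fact_pos m.
by move=> *; field; lra.
Qed.

Lemma is_lim_seq_ln_ratio c : 0 <= c ->
  is_lim_seq (fun m => ln ((INR m + c) / INR m)) 0.
Proof.
move=> hc; rewrite -ln_1.
apply: (is_lim_seq_continuous ln (fun m => (INR m + c) / INR m) 1).
  apply/continuity_pt_filterlim; apply: (@ex_derive_continuous R_AbsRing R_NormedModule).
  by exists (/ 1); apply: is_derive_ln; lra.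
apply: (is_lim_seq_ext_loc (fun m => 1 + c * / INR m)).
  exists 1%N => m hm.
  have hm1 : 1 <= INR m by apply: (le_INR 1).
  by field; lra.
have -> : Rbar.Finite 1 = Rbar.Finite (1 + c * 0) by congr Rbar.Finite; ring.
apply: is_lim_seq_plus'; first exact: is_lim_seq_const.
apply: is_lim_seq_mult'; first exact: is_lim_seq_const.
have -> : Rbar.Finite 0 = Rbar_inv p_infty by [].
apply: is_lim_seq_inv => //; exact: is_lim_seq_INR.
Qed.

(** Here [- Series (log_factor 1)] is Euler's constant, so this is the logarithm of the Weierstrass
    product for 1/Gamma(1 + h). *)
Definition log_rgamma_1p (h : R) : R := Series (log_factor h) - h * Series (log_factor 1).

Lemma is_lim_rgamma_seq_1p h : -1/2 <= h ->
  is_lim_seq (rgamma_seq (1 + h)) (Rbar.Finite (exp (log_rgamma_1p h))).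
Proof.
move=> hh.
apply: (is_lim_seq_ext_loc (fun m => exp (sum_n (log_factor h) m
     - h * sum_n (log_factor 1) m
     + h * ln ((INR m + 2) / INR m) + ln ((INR m + 1) / INR m)))).
  by exists 1%N => m hm; rewrite rgamma_seq_1p //; apply/leP.
apply: (is_lim_seq_continuous exp).
  by apply: derivable_continuous_pt; apply: derivable_pt_exp.
have -> : Rbar.Finite (log_rgamma_1p h) = Rbar.Finite (Series (log_factor h)
   - h * Series (log_factor 1) + h * 0 + 0) by congr Rbar.Finite; rewrite /log_rgamma_1p; ring.
have lf : forall x, -1/2 <= x -> is_lim_seq (sum_n (log_factor x)) (Series (log_factor x)).
  by move=> x hx; exact: Series_correct (ex_series_log_factor _ hx).
apply: is_lim_seq_plus'; last by apply: is_lim_seq_ln_ratio; lra.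
apply: is_lim_seq_plus'; last first.
  by apply: is_lim_seq_mult'; [exact: is_lim_seq_const | apply: is_lim_seq_ln_ratio; lra].
apply: is_lim_seq_minus'; first exact: lf.
by apply: is_lim_seq_mult'; [exact: is_lim_seq_const | apply: lf; lra].
Qed.

Lemma rgamma_1p h : -1/2 <= h -> rgamma (1 + h) = exp (log_rgamma_1p h).
Proof. by move=> hh; apply: rgammaE; apply: is_lim_rgamma_seq_1p. Qed.

(** Shifting the product trades its first factor x for a last factor x + 1 + m; compared with the
    extra power of m this leaves a correction that tends to 1. *)
Lemma rgamma_seq_rec x m : (0 < m)%N -> x + INR m + 1 <> 0 ->
  rgamma_seq x m = x * rgamma_seq (x + 1) m * / (1 + (x + 1) * / INR m).
Proof.
move=> hm hx.
have hm1 : 1 <= INR m by apply: (le_INR 1); apply/leP.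
have hp : x * \big[Rmult/1]_(j < m.+1) (x + 1 + INR j) =
  \big[Rmult/1]_(j < m.+1) (x + INR j) * (x + INR m + 1).
  rewrite [X in x * X](eq_bigr (fun j : 'I_m.+1 => x + INR (j.+1)))
    => [|j _]; last by rewrite S_INR; ring.
  have := @big_ord_recl R 1 Rmult m.+1 (fun j : 'I_m.+2 => x + INR j).
  rewrite big_ord_recr /= Rplus_0_r => <-.
  by rewrite -/(INR m.+1) S_INR; congr (_ * _); ring.
rewrite /rgamma_seq Rpower_plus Rpower_1; last lra.
have h1 := INR_fact_pos m.
have h2 : 0 < Rpower (INR m) x by apply: exp_pos.
have -> : \big[Rmult/1]_(j < m.+1) (x + INR j)
  = x * \big[Rmult/1]_(j < m.+1) (x + 1 + INR j) / (x + INR m + 1).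
  by rewrite hp; field.
field; repeat split; try lra.
Qed.

Lemma is_lim_rgamma_seq_down x l :
  is_lim_seq (rgamma_seq (x + 1)) (Rbar.Finite l) -> is_lim_seq (rgamma_seq x) (Rbar.Finite (x * l)).
Proof.
move=> hl.
have [N hN] := INR_unbounded (Rabs x + 1).
apply: (is_lim_seq_ext_loc
  (fun m => x * rgamma_seq (x + 1) m * / (1 + (x + 1) * / INR m))).
  exists N => m hm; have hNm := le_INR _ _ hm.
  have h1 := Rle_abs (- x); rewrite Rabs_Ropp in h1; have h2 := Rabs_pos x.
  have hm0 : (0 < m)%N by apply/ltP; apply: INR_lt; rewrite /=; lra.
  by rewrite (rgamma_seq_rec x) //; lra.
have -> : Rbar.Finite (x * l) = Rbar.Finite (x * l * / (1 + (x + 1) * 0)).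
  by congr Rbar.Finite; field; lra.
apply: is_lim_seq_mult'.
  by apply: is_lim_seq_mult' => //; exact: is_lim_seq_const.
have h0 : is_lim_seq (fun m => / INR m) 0.
  have -> : Rbar.Finite 0 = Rbar_inv p_infty by [].
  apply: is_lim_seq_inv => //; exact: is_lim_seq_INR.
have h3 : is_lim_seq (fun m => 1 + (x + 1) * / INR m) (1 + (x + 1) * 0).
  apply: is_lim_seq_plus'; first exact: is_lim_seq_const.
  by apply: is_lim_seq_mult' => //; exact: is_lim_seq_const.
apply: (is_lim_seq_inv _ _ h3) => [[]]; lra.
Qed.

(** Convergence holds for x >= 1/2 by the exponential formula, and each use of the recurrence moves
    it one unit to the left. *)
Lemma is_lim_rgamma_seq x : is_lim_seq (rgamma_seq x) (Rbar.Finite (rgamma x)).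
Proof.
have key : forall n, 1/2 <= x + INR n -> exists l, is_lim_seq (rgamma_seq x) (Rbar.Finite l).
  move=> n; elim: n x => [|n IHn] x hx.
    exists (exp (log_rgamma_1p (x - 1))).
    have {1}-> : x = 1 + (x - 1) by ring.
    by apply: is_lim_rgamma_seq_1p; rewrite /= in hx; lra.
  have [|l hl] := IHn (x + 1); first by rewrite S_INR in hx; lra.
  by exists (x * l); apply: is_lim_rgamma_seq_down.
have [N hN] := INR_unbounded (Rabs x + 1).
have h1 := Rle_abs (- x); rewrite Rabs_Ropp in h1.
have [|l hl] := key N; first lra.
by rewrite (rgammaE _ _ hl).
Qed.

Lemma rgamma_rec x : rgamma x = x * rgamma (x + 1).
Proof. by apply: rgammaE; apply: is_lim_rgamma_seq_down; apply: is_lim_rgamma_seq. Qed.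

Lemma rgamma_1 : rgamma 1 = 1.
Proof.
rewrite -{1}(Rplus_0_r 1) rgamma_1p; last lra.
rewrite /log_rgamma_1p (Series_ext _ (fun _ => 0 * 0)) => [|j]; last first.
  by rewrite /log_factor /Rdiv Rmult_0_l Rplus_0_r ln_1; ring.
by rewrite Series_scal_l !Rmult_0_l Rminus_0_r exp_0.
Qed.

Lemma rgamma_pos x : 0 < x -> 0 < rgamma x.
Proof.
move=> hx; rewrite rgamma_rec; apply: Rmult_lt_0_compat => //.
by rewrite Rplus_comm rgamma_1p; [exact: exp_pos | lra].
Qed.

(** * Expansion of 1/Gamma at the integers *)

(** From [1 + x <= exp x] at -w one gets exp w - 1 <= w exp w. Used twice when w >= 0, this bounds
    the remainder by w (exp w - 1) and then by w^2 exp w; for w < 0 the first bound is already at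
    most w^2. *)
Lemma exp_sub_1_sub_bound w : Rabs (exp w - 1 - w) <= w ^ 2 * exp (Rabs w).
Proof.
have h1 := exp_ineq1_le w; have h2 := exp_ineq1_le (- w).
have e0 := exp_pos w.
have h3 : exp w - 1 <= w * exp w.
  have : (1 - w) * exp w <= exp (- w) * exp w.
    by apply: Rmult_le_compat_r; lra.
  by rewrite -exp_plus Rplus_opp_l exp_0; lra.
rewrite Rabs_pos_eq; last lra.
case: (Rle_lt_dec 0 w) => hw.
  rewrite Rabs_pos_eq //.
  have : w * (exp w - 1) <= w * (w * exp w) by apply: Rmult_le_compat_l.
  by rewrite /=; lra.
rewrite Rabs_left //.
have : 1 <= exp (- w) by lra.
by have := pow2_ge_0 w; nra.
Qed.

(** Differentiability at a with slope l, made quantitative so that one K can serve infinitely many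
    points a. *)
Definition quadratic_remainder (a l K : R) : Prop :=
  forall h, Rabs h <= 1/2 -> Rabs (rgamma (a + h) - rgamma a - h * l) <= K * h ^ 2.

Lemma quadratic_remainder_mono a l K K' :
  K <= K' -> quadratic_remainder a l K -> quadratic_remainder a l K'.
Proof.
move=> hK hq h hh; apply: Rle_trans (hq h hh) _.
by apply: Rmult_le_compat_r => //; exact: pow2_ge_0.
Qed.

Lemma quadratic_remainder_1 : exists l K, 0 <= K /\ quadratic_remainder 1 l K.
Proof.
have [K [hK hS]] := Series_log_factor_bound.
set s := Series (log_factor 1).
set W := K + Rabs s.
have hW : 0 <= W by have := Rabs_pos s; rewrite /W; lra.
exists (- s), (W ^ 2 * exp W + K); split.
  by have := pow2_ge_0 W; have := exp_pos W; nra.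
move=> h hh.
have hh1 : -1/2 <= h by move: hh; rewrite /Rabs; case: Rcase_abs; lra.
have := hS h hh1; set S := Series (log_factor h) => hSh.
have ha := Rabs_pos h.
have hw : Rabs (S - h * s) <= W * Rabs h.
  apply: Rle_trans (Rabs_triang _ _) _; rewrite Rabs_Ropp Rabs_mult /W.
  have : h ^ 2 = Rabs h ^ 2 by rewrite pow2_abs.
  move=> e; rewrite e in hSh.
  have : K * Rabs h ^ 2 <= K * Rabs h by apply: Rmult_le_compat_l => //; nra.
  by lra.
rewrite rgamma_1p // rgamma_1 /log_rgamma_1p -/S -/s.
(* The exponent is w = S - h s with S of order h^2. Its linear part -h s carries the slope, so the
   remainder is (exp w - 1 - w) + S, and |w| <= W |h| controls the first term. *)
replace (exp (S - h * s) - 1 - h * - s)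
  with ((exp (S - h * s) - 1 - (S - h * s)) + S) by ring.
apply: Rle_trans (Rabs_triang _ _) _.
rewrite Rmult_plus_distr_r; apply: Rplus_le_compat => //.
apply: Rle_trans (exp_sub_1_sub_bound _) _.
have h2 : (S - h * s) ^ 2 <= W ^ 2 * h ^ 2.
  rewrite -Rpow_mult_distr -(pow2_abs (S - _)) -(pow2_abs (W * h)) Rabs_mult (Rabs_pos_eq W) //.
  by apply: pow_incr; split => //; exact: Rabs_pos.
have h3 : exp (Rabs (S - h * s)) <= exp W.
  have : Rabs (S - h * s) <= W by nra.
  by case=> [/exp_increasing|->]; lra.
have := pow2_ge_0 (S - h * s); have := exp_pos (Rabs (S - h * s)).
have := pow2_ge_0 W; have := pow2_ge_0 h => *.
have := Rmult_le_compat _ _ _ _ (pow2_ge_0 _) (Rlt_le _ _ (exp_pos _)) h2 h3.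
by lra.
Qed.

(** Differentiating rgamma a = a rgamma (a + 1) dictates the new slope. The step divides by a + h >=
    a - 1/2, which is what keeps the constants bounded when it is iterated to the right. *)
Lemma quadratic_remainder_succ a l K B : 1 <= a ->
  Rabs ((l - rgamma (a + 1)) / a) <= B -> quadratic_remainder a l K ->
  quadratic_remainder (a + 1) ((l - rgamma (a + 1)) / a) ((K + B) / (a - 1/2)).
Proof.
move=> ha; set l' := (l - _) / a => hB hq h hh.
have hh1 : -1/2 <= h by move: hh; rewrite /Rabs; case: Rcase_abs; lra.
have e : rgamma (a + 1 + h) - rgamma (a + 1) - h * l' =
  ((rgamma (a + h) - rgamma a - h * l) - h ^ 2 * l') / (a + h).
  rewrite (rgamma_rec (a + h)) (rgamma_rec a).
  replace (a + h + 1) with (a + 1 + h) by ring.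
  by rewrite /l'; field; lra.
rewrite e Rabs_div; last lra.
rewrite (Rabs_pos_eq (a + h)); last lra.
have h1 : Rabs (rgamma (a + h) - rgamma a - h * l - h ^ 2 * l') <= (K + B) * h ^ 2.
  apply: Rle_trans (Rabs_triang _ _) _.
  rewrite Rabs_Ropp Rabs_mult (Rabs_pos_eq (h ^ 2)); last exact: pow2_ge_0.
  by have := hq h hh; have := pow2_ge_0 h; nra.
have h2 := Rle_trans _ _ _ (Rabs_pos _) h1.
apply: (Rle_trans _ ((K + B) * h ^ 2 / (a + h))).
  by apply: Rmult_le_compat_r => //; apply: Rlt_le; apply: Rinv_0_lt_compat; lra.
rewrite /Rdiv (Rmult_assoc _ (/ _)) (Rmult_comm (/ _)) -Rmult_assoc.
by apply: Rmult_le_compat_l => //; apply: Rinv_le_contravar; lra.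
Qed.

(** A step to the left multiplies by a + h, so it passes through the zeros of 1/Gamma; the constant
    may grow, but only finitely many such steps are taken. *)
Lemma quadratic_remainder_pred a l K : quadratic_remainder (a + 1) l K ->
  quadratic_remainder a (rgamma (a + 1) + a * l) ((Rabs a + 1/2) * K + Rabs l).
Proof.
move=> hq h hh.
rewrite (rgamma_rec (a + h)) (rgamma_rec a).
replace (a + h + 1) with (a + 1 + h) by ring.
replace ((a + h) * rgamma (a + 1 + h) - a * rgamma (a + 1) - h * (rgamma (a + 1) + a * l))
  with ((a + h) * (rgamma (a + 1 + h) - rgamma (a + 1) - h * l) + h ^ 2 * l) by ring.
apply: Rle_trans (Rabs_triang _ _) _.
rewrite Rabs_mult (Rabs_mult (h ^ 2)) (Rabs_pos_eq (h ^ 2)); last exact: pow2_ge_0.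
have h1 := hq h hh.
have h2 : Rabs (a + h) <= Rabs a + 1/2.
  by apply: Rle_trans (Rabs_triang _ _) _; lra.
have := Rmult_le_compat _ _ _ _ (Rabs_pos _) (Rabs_pos _) h2 h1.
by lra.
Qed.

(* [l j] plays the role of the derivative of [rgamma] at [b + j]. *)
Definition derivative_sequence (b : R) (l : nat -> R) (K : R) : Prop :=
  0 <= K /\
  (forall j, quadratic_remainder (b + INR j) (l j) K) /\
  (forall j, Rabs (l j) <= K) /\
  (forall j, l j = rgamma (b + INR j + 1) + (b + INR j) * l j.+1).

Lemma rgamma_succ_le1 j : 0 <= rgamma (1 + INR j) <= 1.
Proof.
elim: j => [|j IHj]; first by rewrite /= Rplus_0_r rgamma_1; lra.
have hj := pos_INR j.
have h : rgamma (1 + INR j) = (1 + INR j) * rgamma (1 + INR j.+1).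
  by rewrite rgamma_rec S_INR; congr (_ * rgamma _); ring.
have : 0 < rgamma (1 + INR j.+1) by apply: rgamma_pos; rewrite S_INR; lra.
by nra.
Qed.

Lemma derivative_sequence_1 : exists l K, derivative_sequence 1 l K.
Proof.
have [l0 [K0 [hK0 hq0]]] := quadratic_remainder_1.
pose l : nat -> R := nat_rect (fun _ => R) l0 (fun j x => (x - rgamma (1 + INR j + 1)) / (1 + INR j)).
(* The first slope changes by at most 1, giving B; later ones are at most (B + 1)/2 <= B. For K, the
   first step divides K0 + B by 1 - 1/2, hence the factor 2; every later step divides K + B by at
   least 3/2, and (K + B)/(3/2) <= K because 2 B <= K. *)
pose B := Rabs l0 + 1; pose K := 2 * (K0 + B).
have hB : 1 <= B by have := Rabs_pos l0; rewrite /B; lra.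
have hg j : Rabs (rgamma (1 + INR j + 1)) <= 1.
  have -> : 1 + INR j + 1 = 1 + INR j.+1 by rewrite S_INR; ring.
  by have := rgamma_succ_le1 j.+1 => ?; apply: Rabs_le; lra.
have hl j : Rabs (l j) <= B.
  case: j => [|j]; first by rewrite /l /B /=; lra.
  elim: j => [|j IHj].
    rewrite /l /= Rplus_0_r /Rdiv Rinv_1 Rmult_1_r.
    apply: Rle_trans (Rabs_triang _ _) _; rewrite Rabs_Ropp.
    by have := hg 0%N; rewrite /= Rplus_0_r /B; lra.
  rewrite -[l j.+2]/((l j.+1 - rgamma (1 + INR j.+1 + 1)) / (1 + INR j.+1)).
  have hj := pos_INR j.
  rewrite Rabs_div; last by rewrite S_INR; lra.
  rewrite (Rabs_pos_eq (1 + _)); last by rewrite S_INR; lra.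
  apply: (Rmult_le_reg_r (1 + INR j.+1)); first by rewrite S_INR; lra.
  rewrite /Rdiv Rmult_assoc Rinv_l; last by rewrite S_INR; lra.
  rewrite Rmult_1_r; apply: Rle_trans (Rabs_triang _ _) _; rewrite Rabs_Ropp.
  by have := hg j.+1; rewrite S_INR; nra.
have hq j : quadratic_remainder (1 + INR j) (l j) K.
  case: j => [|j].
    rewrite /= Rplus_0_r; apply: quadratic_remainder_mono hq0; rewrite /K; lra.
  elim: j => [|j IHj].
    have := @quadratic_remainder_succ 1 l0 K0 B _ _ hq0.
    have e : (l0 - rgamma (1 + 1)) / 1 = l 1%N by rewrite /l /= Rplus_0_r.
    rewrite e => h; apply: quadratic_remainder_mono (h (Rle_refl 1) (hl 1%N)).
    by rewrite /K; lra.
  have hj := pos_INR j.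
  have := @quadratic_remainder_succ (1 + INR j.+1) (l j.+1) K B _ _ IHj.
  rewrite -[_ / _]/(l j.+2) => h.
  have -> : 1 + INR j.+2 = 1 + INR j.+1 + 1 by rewrite !S_INR; ring.
  have h1 : 1 <= 1 + INR j.+1 by rewrite S_INR; lra.
  apply: quadratic_remainder_mono (h h1 (hl _)).
  apply: (Rmult_le_reg_r (1 + INR j.+1 - 1/2)); first by rewrite S_INR; lra.
  rewrite /Rdiv Rmult_assoc Rinv_l; last by rewrite S_INR; lra.
  by rewrite /K S_INR; nra.
exists l, K; split; first by rewrite /K; lra.
split=> //; split=> [j|j]; first by have := hl j; rewrite /K; lra.
rewrite -[l j.+1]/((l j - rgamma (1 + INR j + 1)) / (1 + INR j)).
by have := pos_INR j => hj; move: (l j) => x; cbv beta; field; lra.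
Qed.

Lemma derivative_sequence_succ b l K :
  derivative_sequence b l K -> derivative_sequence (b + 1) (fun j => l j.+1) K.
Proof.
move=> [hK [h1 [h2 h3]]].
have e j : b + 1 + INR j = b + INR j.+1 by rewrite S_INR; ring.
by split=> //; split=> [j|]; [rewrite e | split=> // j; rewrite e].
Qed.

Lemma derivative_sequence_pred b l K : derivative_sequence (b + 1) l K ->
  exists l' K', derivative_sequence b l' K'.
Proof.
move=> [hK [h1 [h2 h3]]].
pose l0 := rgamma (b + 1) + b * l 0%N.
have e j : b + INR j.+1 = b + 1 + INR j by rewrite S_INR; ring.
exists (fun j => if j is i.+1 then l i else l0), ((Rabs b + 1/2) * K + K + Rabs l0).
have hb := Rabs_pos b; have hl0 := Rabs_pos l0.
have hbK : 0 <= Rabs b * K by apply: Rmult_le_pos.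
split; first by lra.
split; [|split].
- case=> [|j]; last first.
    by rewrite e; apply: quadratic_remainder_mono (h1 j); lra.
  rewrite /= Rplus_0_r.
  have := h1 0%N; rewrite /= Rplus_0_r => /quadratic_remainder_pred.
  by apply: quadratic_remainder_mono; have := h2 0%N; lra.
- by case=> [|j]; [|have := h2 j]; lra.
case=> [|j]; first by rewrite /= Rplus_0_r.
by rewrite e; exact: h3.
Qed.

(** The points m + 1 + j, and -m + 1 + j in the next lemma, are the arguments of 1/Gamma in the
    coefficients of [clifford] at the orders m and -m. *)
Lemma derivative_sequence_pos m : exists l K, derivative_sequence (INR m + 1) l K.
Proof.
elim: m => [|m [l [K h]]]; first by rewrite /= Rplus_0_l; exact: derivative_sequence_1.
by exists (fun j => l j.+1), K; rewrite S_INR; exact: derivative_sequence_succ.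
Qed.

Lemma derivative_sequence_neg m : exists l K, derivative_sequence (- INR m + 1) l K.
Proof.
elim: m => [|m [l [K h]]].
  by rewrite /= Ropp_0 Rplus_0_l; exact: derivative_sequence_1.
apply: (@derivative_sequence_pred _ l K).
by have -> : - INR m.+1 + 1 + 1 = - INR m + 1 by rewrite S_INR; ring.
Qed.

Lemma rgamma_neg m : rgamma (- INR m) = 0.
Proof.
elim: m => [|m IHm]; rewrite rgamma_rec; first by rewrite /= Ropp_0 Rmult_0_l.
have -> : - INR m.+1 + 1 = - INR m by rewrite S_INR; ring.
by rewrite IHm Rmult_0_r.
Qed.

(* [rgamma] has simple zeros at [0, -1, -2, ...] *)
Lemma derivative_sequence_head_neq0 m l K :
  derivative_sequence (- INR m) l K -> l 0%N <> 0.
Proof.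
elim: m l => [|m IHm] l h.
  move: h => [_ [_ [_ /(_ 0%N)]]].
  by rewrite /= Ropp_0 !Rplus_0_l Rmult_0_l rgamma_1 => ->; lra.
have := derivative_sequence_succ _ _ _ h.
have e : - INR m.+1 + 1 = - INR m by rewrite S_INR; ring.
rewrite e => /IHm h1; move: h => [_ [_ [_ /(_ 0%N)]]].
rewrite Rplus_0_r e rgamma_neg Rplus_0_l => ->.
by apply: Rmult_integral_contrapositive_currified => //; rewrite S_INR; have := pos_INR m; lra.
Qed.

(** * The Bessel-Clifford series *)

(** Domination by a multiple of the exponential series: the class is stable under [PS_derive] and
    its members are entire. *)
Definition factorially_bounded (a : nat -> R) : Prop :=
  exists M, forall j, Rabs (a j) <= M / INR (fact j).

Lemma is_series_exp_scal M x :
  is_series (fun j => M * (Rabs x ^ j / INR (fact j))) (M * exp (Rabs x)).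
Proof.
apply: (is_series_scal M (fun j => Rabs x ^ j / INR (fact j)) (exp (Rabs x))).
have := is_exp_Reals (Rabs x); apply: is_series_ext => j.
by rewrite pow_n_pow.
Qed.

Lemma factorially_bounded_term a M x j :
  Rabs (a j) <= M / INR (fact j) ->
  Rabs (a j * x ^ j) <= M * (Rabs x ^ j / INR (fact j)).
Proof.
move=> h; rewrite Rabs_mult -RPow_abs.
replace (M * (Rabs x ^ j / INR (fact j))) with (M / INR (fact j) * Rabs x ^ j).
  by apply: Rmult_le_compat_r => //; apply: pow_le; exact: Rabs_pos.
by have := INR_fact_pos j => ?; field; lra.
Qed.

Lemma factorially_bounded_CV_disk a x : factorially_bounded a -> CV_disk a x.
Proof.
move=> [M hM]; apply: (ex_series_le _ (fun j => M * (Rabs x ^ j / INR (fact j)))).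
  move=> j; rewrite /norm /= /abs /= Rabs_Rabsolu.
  exact: factorially_bounded_term.
by exists (M * exp (Rabs x)); exact: is_series_exp_scal.
Qed.

Lemma factorially_bounded_CV_radius a : factorially_bounded a -> CV_radius a = p_infty.
Proof.
move=> h; have [ub _] := Lub_Rbar_correct (CV_disk a); rewrite -/(CV_radius a) in ub.
case: (CV_radius a) ub => [r|//|] ub.
  by have := ub _ (factorially_bounded_CV_disk a (r + 1) h); rewrite /=; lra.
by have := ub _ (factorially_bounded_CV_disk a 0 h).
Qed.

Lemma factorially_bounded_ex_pseries a x : factorially_bounded a -> ex_pseries a x.
Proof. by move=> h; apply: CV_disk_correct; exact: factorially_bounded_CV_disk. Qed.

Lemma factorially_bounded_derive a :
  factorially_bounded a -> factorially_bounded (PS_derive a).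
Proof.
move=> [M hM]; exists M => j; rewrite /PS_derive Rabs_mult.
have hj := pos_INR j; have hf := INR_fact_pos j.
rewrite (Rabs_pos_eq (INR _)); last exact: pos_INR.
have := hM j.+1; rewrite fact_simpl mult_INR S_INR => h.
have := Rmult_le_compat_l (INR j + 1) _ _ _ h.
have -> : (INR j + 1) * (M / ((INR j + 1) * INR (fact j))) = M / INR (fact j).
  by field; lra.
by apply; lra.
Qed.

Lemma factorially_bounded_is_derive a x : factorially_bounded a ->
  is_derive (PSeries a) x (PSeries (PS_derive a) x).
Proof.
by move=> h; apply: is_derive_PSeries; rewrite factorially_bounded_CV_radius.
Qed.

(** The hypothesis compares the coefficients of x^j in x y'' + c y' + y. The source [b] is zero for
    [clifford] itself, but not for its derivative in the order. *)
Lemma PSeries_bessel_equation a b c x : factorially_bounded a ->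
  (forall j, (INR j + 1) * (INR j + c) * a j.+1 + a j = b j) ->
  x * PSeries (PS_derive (PS_derive a)) x + c * PSeries (PS_derive a) x + PSeries a x
  = PSeries b x.
Proof.
move=> ha hab.
have ha1 := factorially_bounded_derive _ ha.
have ha2 := factorially_bounded_derive _ ha1.
have e0 := factorially_bounded_ex_pseries _ x ha.
have e1 := factorially_bounded_ex_pseries _ x ha1.
have e2 := factorially_bounded_ex_pseries _ x ha2.
rewrite -PSeries_incr_1 -PSeries_scal.
have i2 := ex_pseries_incr_1 _ x e2.
have s1 : ex_pseries (PS_scal c (PS_derive a)) x.
  by apply: ex_pseries_scal => //; exact: Rmult_comm.
rewrite -PSeries_plus // -PSeries_plus //; last exact: ex_pseries_plus.
apply: PSeries_ext => j; rewrite -hab /PS_plus /PS_scal /PS_derive /plus /scal /=.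
rewrite /mult /=; case: j => [|j]; rewrite /PS_incr_1 /zero /=; first ring.
by rewrite -/(INR j.+1) -/(INR j.+2) !S_INR; ring.
Qed.

Definition alternating_exp_coef (l : nat -> R) (j : nat) : R :=
  (-1) ^ j / INR (fact j) * l j.

Lemma alternating_exp_coef_bounded l M :
  (forall j, Rabs (l j) <= M) -> factorially_bounded (alternating_exp_coef l).
Proof.
move=> hl; exists M => j; rewrite /alternating_exp_coef Rabs_mult.
have hf := INR_fact_pos j.
rewrite Rabs_div; last lra.
rewrite (Rabs_pos_eq (INR _)); last lra.
rewrite pow_1_abs /Rdiv Rmult_1_l Rmult_comm.
by apply: Rmult_le_compat_r => //; apply: Rlt_le; exact: Rinv_0_lt_compat.
Qed.

(** To the right of 1 the recurrence divides by numbers at least 1, so the values decrease in size;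
    only finitely many translates lie further left. *)
Lemma rgamma_translates_bounded x : exists M, forall j, Rabs (rgamma (INR j + x)) <= M.
Proof.
have hbig : forall y, 1 <= y -> forall j, Rabs (rgamma (INR j + y)) <= Rabs (rgamma y).
  move=> y hy; elim=> [|j IHj]; first by rewrite /= Rplus_0_l; lra.
  apply: Rle_trans IHj.
  have hj := pos_INR j.
  rewrite (rgamma_rec (INR j + y)) Rabs_mult (Rabs_pos_eq (INR j + y)); last lra.
  have -> : INR j.+1 + y = INR j + y + 1 by rewrite S_INR; ring.
  by have := Rabs_pos (rgamma (INR j + y + 1)); nra.
have key : forall N x, 1 <= x + INR N -> exists M, forall j, Rabs (rgamma (INR j + x)) <= M.
  clear x; elim=> [|N IHN] x hx.
    by exists (Rabs (rgamma x)); apply: hbig; rewrite /= in hx; lra.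
  have [|M hM] := IHN (x + 1); first by rewrite S_INR in hx; lra.
  exists (M + Rabs (rgamma x)); case=> [|j].
    by rewrite /= Rplus_0_l; have := hM 0%N; have := Rabs_pos (rgamma (INR 0 + (x + 1))); lra.
  have -> : INR j.+1 + x = INR j + (x + 1) by rewrite S_INR; ring.
  by have := hM j; have := Rabs_pos (rgamma x); lra.
have [N hN] := INR_unbounded (Rabs x + 1).
have h1 := Rle_abs (- x); rewrite Rabs_Ropp in h1.
by apply: (key N); lra.
Qed.

Definition clifford_coef (nu : R) : nat -> R :=
  alternating_exp_coef (fun j => rgamma (INR j + nu + 1)).

Definition clifford (nu t : R) : R := PSeries (clifford_coef nu) t.

Lemma besselJE nu z : besselJ nu z = Rpower (z / 2) nu * clifford nu ((z / 2) ^ 2).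
Proof. by []. Qed.

Lemma clifford_coef_bounded nu : factorially_bounded (clifford_coef nu).
Proof.
have [M hM] := rgamma_translates_bounded (nu + 1).
apply: (@alternating_exp_coef_bounded _ M) => j.
by have -> : INR j + nu + 1 = INR j + (nu + 1) by ring.
Qed.

Lemma clifford_coef_rec nu j :
  (INR j + 1) * (INR j + (nu + 1)) * clifford_coef nu j.+1 + clifford_coef nu j = 0.
Proof.
rewrite /clifford_coef /alternating_exp_coef (rgamma_rec (INR j + nu + 1)).
rewrite fact_simpl mult_INR S_INR -tech_pow_Rmult.
have -> : INR j + 1 + nu + 1 = INR j + nu + 1 + 1 by ring.
have := pos_INR j; have := INR_fact_pos j => *.
by field; lra.
Qed.

Lemma clifford_0 nu : clifford nu 0 = rgamma (nu + 1).
Proof.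
rewrite /clifford PSeries_0 /clifford_coef /alternating_exp_coef /=.
by rewrite Rplus_0_l; field.
Qed.

(** This is [clifford_coef_rec] differentiated in the order: the factor j + nu + 1 contributes the
    source, which is minus the t-derivative of [clifford nu]. *)
Lemma derivative_coef_rec nu l K j : derivative_sequence (nu + 1) l K ->
  (INR j + 1) * (INR j + (nu + 1)) * alternating_exp_coef l j.+1 + alternating_exp_coef l j
  = - PS_derive (clifford_coef nu) j.
Proof.
move=> [_ [_ [_ /(_ j) h]]].
rewrite /clifford_coef /PS_derive /alternating_exp_coef h.
rewrite fact_simpl mult_INR S_INR -tech_pow_Rmult.
have -> : INR j + 1 + nu + 1 = nu + 1 + INR j + 1 by ring.
have := pos_INR j; have := INR_fact_pos j => *.
by field; lra.
Qed.

Lemma PSeries_0_upto a m t : (forall j, (j < m)%N -> a j = 0) ->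
  PSeries a t = t ^ m * PSeries (fun j => a (m + j)%N) t.
Proof.
move=> ha; rewrite -PSeries_incr_n; apply: PSeries_ext => j.
elim: m a j ha => [|m IHm] a j ha //=.
case: j => [|j]; first by rewrite ha.
rewrite /PS_incr_1 -(IHm (fun j => a j.+1)) // => i hi; exact: ha.
Qed.

(** The series form of J_(-m) = (-1)^m J_m: 1/Gamma vanishes at the nonpositive integers, which
    kills the first m coefficients at order -m, and the others are those of order m shifted by m. *)
Lemma clifford_neg_INR m t : clifford (- INR m) t = (-1) ^ m * t ^ m * clifford (INR m) t.
Proof.
rewrite /clifford (@PSeries_0_upto (clifford_coef (- INR m)) m); last first.
  move=> j hj; rewrite /clifford_coef /alternating_exp_coef.
  have -> : INR j + - INR m + 1 = - INR (m - j.+1)%N.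
    by rewrite minus_INR ?S_INR; [ring | apply/leP].
  by rewrite rgamma_neg Rmult_0_r.
rewrite (PSeries_ext _ (PS_scal ((-1) ^ m) (clifford_coef (INR m)))).
  by rewrite PSeries_scal; ring.
move=> j; rewrite /PS_scal /scal /= /mult /= /clifford_coef /alternating_exp_coef pow_add.
have -> : INR (m + j) + - INR m + 1 = INR (j + 1) by rewrite !plus_INR /=; ring.
have -> : INR j + INR m + 1 = INR (m + j + 1) by rewrite !plus_INR /=; ring.
have hfact i : rgamma (INR (i + 1)) = / INR (fact i).
  elim: i => [|i IHi]; first by rewrite /= rgamma_1 Rinv_1.
  have := rgamma_rec (INR (i + 1)); rewrite IHi fact_simpl mult_INR.
  have -> : INR (i + 1) + 1 = INR (i.+1 + 1) by rewrite -S_INR addSn.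
  rewrite addn1 => h; have := INR_fact_pos i; have : INR i.+1 <> 0 by exact: not_0_INR.
  by move=> h1 h2; rewrite Rinv_mult h; field.
rewrite !hfact; have := INR_fact_pos j; have := INR_fact_pos (m + j) => *.
by field; lra.
Qed.

(** The bound for 1/Gamma, uniform in j, is applied coefficient by coefficient; the weights |t|^j /
    j! add up to exp |t|. *)
Lemma clifford_quadratic_remainder nu l K t h : derivative_sequence (nu + 1) l K ->
  Rabs h <= 1/2 ->
  Rabs (clifford (nu + h) t - clifford nu t - h * PSeries (alternating_exp_coef l) t)
    <= K * exp (Rabs t) * h ^ 2.
Proof.
move=> [hK [hq [hl _]]] hh.
have e1 := factorially_bounded_ex_pseries _ t (clifford_coef_bounded (nu + h)).
have e2 := factorially_bounded_ex_pseries _ t (clifford_coef_bounded nu).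
have e3 := factorially_bounded_ex_pseries _ t (alternating_exp_coef_bounded _ _ hl).
have e3' : ex_pseries (PS_scal h (alternating_exp_coef l)) t.
  by apply: ex_pseries_scal => //; exact: Rmult_comm.
rewrite /clifford -PSeries_scal -PSeries_minus // -PSeries_minus //; last first.
  exact: ex_pseries_minus.
set a := PS_minus _ _.
have ha j : Rabs (a j) <= K * h ^ 2 / INR (fact j).
  have -> : a j = (-1) ^ j * / INR (fact j) * (rgamma (nu + 1 + INR j + h)
     - rgamma (nu + 1 + INR j) - h * l j).
    rewrite /a /PS_minus /PS_plus /PS_opp /PS_scal /plus /opp /scal /= /mult /=.
    rewrite /clifford_coef /alternating_exp_coef.
    have -> : INR j + (nu + h) + 1 = nu + 1 + INR j + h by ring.
    have -> : INR j + nu + 1 = nu + 1 + INR j by ring.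
    by rewrite /Rdiv; ring.
  have hf : 0 < / INR (fact j) by apply: Rinv_0_lt_compat; exact: INR_fact_pos.
  rewrite !Rabs_mult pow_1_abs (Rabs_pos_eq (/ _)); last lra.
  by have := hq j h hh; rewrite /Rdiv; nra.
have hb : factorially_bounded a by exists (K * h ^ 2).
have := factorially_bounded_CV_disk a t hb => hd.
apply: Rle_trans (Series_Rabs _ hd) _.
have := is_series_exp_scal (K * h ^ 2) t => hs.
have -> : K * exp (Rabs t) * h ^ 2 = Series (fun j => K * h ^ 2 * (Rabs t ^ j / INR (fact j))).
  by rewrite (is_series_unique _ _ hs); ring.
apply: Series_le; last by exists (K * h ^ 2 * exp (Rabs t)).
by move=> j; split; [exact: Rabs_pos | exact: factorially_bounded_term].
Qed.

(** * The Neumann function of integer order *)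

Lemma is_derive_quadratic_remainder f l K :
  (forall h, Rabs h <= 1/2 -> Rabs (f h - f 0 - h * l) <= K * h ^ 2) -> is_derive f 0 l.
Proof.
move=> hf; apply/is_derive_Reals => eps heps.
have hd : 0 < Rmin (1/2) (eps / (Rabs K + 1)).
  apply: Rmin_pos; first lra.
  by apply: Rdiv_lt_0_compat => //; have := Rabs_pos K; lra.
exists (mkposreal _ hd) => h h0 /= hh.
have hh1 := Rlt_le_trans _ _ _ hh (Rmin_l _ _).
have hh2 := Rlt_le_trans _ _ _ hh (Rmin_r _ _).
rewrite Rplus_0_l.
have -> : (f h - f 0) / h - l = (f h - f 0 - h * l) / h by field.
rewrite Rabs_div //; have ha := Rabs_pos_lt h h0.
apply: (Rmult_lt_reg_r (Rabs h)) => //.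
rewrite /Rdiv Rmult_assoc Rinv_l; last lra.
rewrite Rmult_1_r; apply: Rle_lt_trans (hf h (Rlt_le _ _ hh1)) _.
have hK := Rle_abs K; have hK0 := Rabs_pos K.
have : Rabs h * (Rabs K + 1) < eps.
  have := Rmult_lt_compat_r (Rabs K + 1) _ _ _ hh2.
  have -> : eps / (Rabs K + 1) * (Rabs K + 1) = eps by field; lra.
  by apply; lra.
rewrite -(pow2_abs h) => h3.
have : K * Rabs h ^ 2 <= Rabs K * Rabs h ^ 2.
  by apply: Rmult_le_compat_r => //; exact: pow2_ge_0.
by nra.
Qed.

Lemma is_lim_seq_diff_quotient f l : f 0 = 0 -> is_derive f 0 l ->
  is_lim_seq (fun i => f (/ (INR i + 1)) / (/ (INR i + 1))) l.
Proof.
move=> f0 /is_derive_Reals hf; apply/is_lim_seq_spec => eps.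
have [delta hd] := hf eps (cond_pos eps).
have [N hN] := INR_unbounded (/ delta).
exists N => i hi.
have hi2 := le_INR _ _ hi; have hdl := cond_pos delta.
have h0 : 0 < / delta by apply: Rinv_0_lt_compat.
have hp : 0 < / (INR i + 1) by apply: Rinv_0_lt_compat; have := pos_INR i; lra.
have := hd (/ (INR i + 1)); rewrite Rplus_0_l f0 Rminus_0_r; apply; first lra.
rewrite Rabs_pos_eq; last lra.
rewrite -(Rinv_inv delta); apply: Rinv_lt_contravar; last lra.
by apply: Rmult_lt_0_compat; lra.
Qed.

(** L'Hospital's rule at a common zero. [Lim] at x is by definition the limit along x + 1/(i + 1),
    so difference quotients along this sequence decide it. *)
Lemma Lim_quotient_of_derive f g x a b : f x = 0 -> g x = 0 ->
  is_derive f x a -> is_derive g x b -> b <> 0 -> Lim (fun y => f y / g y) x = a / b.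
Proof.
move=> f0 g0 hf hg hb; apply: is_lim_seq_unique => /=.
have hsh (u : R -> R) (l : R) : is_derive u x l -> is_derive (fun h => u (x + h)) 0 l.
  move=> hu.
  have := is_derive_comp u (fun h => x + h) 0 l 1.
  rewrite Rplus_0_r /scal /= /mult /= Rmult_1_l; apply=> //.
  by auto_derive => //; ring.
apply: (is_lim_seq_ext (fun i => (f (x + / (INR i + 1)) / (/ (INR i + 1))) /
   (g (x + / (INR i + 1)) / (/ (INR i + 1))))).
  move=> i; have h0 : / (INR i + 1) <> 0.
    by apply: Rinv_neq_0_compat; have := pos_INR i; lra.
  move: (/ (INR i + 1)) h0 => h h0; rewrite /Rdiv Rinv_mult Rinv_inv.
  replace (f (x + h) * / h * (/ g (x + h) * h))
    with (f (x + h) * / g (x + h) * (/ h * h)) by ring.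
  by rewrite Rinv_l // Rmult_1_r.
apply: is_lim_seq_div' => //.
  by apply: (is_lim_seq_diff_quotient (fun h => f (x + h))); [rewrite Rplus_0_r | exact: hsh].
by apply: (is_lim_seq_diff_quotient (fun h => g (x + h))); [rewrite Rplus_0_r | exact: hsh].
Qed.

Lemma cos_INR_PI m : cos (INR m * PI) = (-1) ^ m.
Proof.
elim: m => [|m IHm]; first by rewrite /= Rmult_0_l cos_0.
have -> : INR m.+1 * PI = INR m * PI + PI by rewrite S_INR; ring.
by rewrite neg_cos IHm /=; ring.
Qed.

Lemma sin_INR_PI m : sin (INR m * PI) = 0.
Proof.
elim: m => [|m IHm]; first by rewrite /= Rmult_0_l sin_0.
have -> : INR m.+1 * PI = INR m * PI + PI by rewrite S_INR; ring.
by rewrite neg_sin IHm; ring.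
Qed.

Lemma sqr_pow_m1 m : (-1) ^ m * (-1) ^ m = 1.
Proof. by rewrite -Rpow_mult_distr; replace (-1 * -1) with 1 by ring; rewrite pow1. Qed.

Lemma is_derive_clifford_order nu l K t : derivative_sequence (nu + 1) l K ->
  is_derive (fun mu => clifford mu t) nu (PSeries (alternating_exp_coef l) t).
Proof.
move=> hl.
have h0 : is_derive (fun h => clifford (nu + h) t) 0 (PSeries (alternating_exp_coef l) t).
  apply: (@is_derive_quadratic_remainder _ _ (K * exp (Rabs t))) => h hh.
  rewrite Rplus_0_r; exact: clifford_quadratic_remainder.
have := is_derive_comp (fun h => clifford (nu + h) t) (fun mu => mu - nu) nu _ 1.
rewrite /Rminus Rplus_opp_r => /(_ _ h0).
rewrite /scal /= /mult /= Rmult_1_l => h1.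
apply: is_derive_ext (h1 _) => [mu|]; first (by congr (clifford _ t); rewrite Rplus_comm; ring).
by auto_derive => //; ring.
Qed.

Lemma is_derive_neumann_numerator (c : R -> R) L x E F :
  is_derive c x E -> is_derive c (- x) F ->
  is_derive (fun mu => exp (mu * L) * c mu * cos (mu * PI) - exp (- mu * L) * c (- mu)) x
   ((L * exp (x * L) * c x + exp (x * L) * E) * cos (x * PI)
    - exp (x * L) * c x * (PI * sin (x * PI))
    + (L * exp (- x * L) * c (- x) + exp (- x * L) * F)).
Proof.
move=> hE hF; auto_derive.
  by repeat split => //; [exists E | exists F].
by rewrite (is_derive_unique _ _ _ hE) (is_derive_unique _ _ _ hF); ring.
Qed.

(** The outcome of l'Hospital's rule after division by (z/2)^m. The two series are the derivatives
    of C_mu in mu at m and at -m; the logarithms coming from (z/2)^mu and (z/2)^(-mu) add up to 2 ln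
    (z/2) = ln t. *)
Definition neumann_clifford (m : nat) (lp lm : nat -> R) (t : R) : R :=
  / PI * (ln t * clifford (INR m) t + PSeries (alternating_exp_coef lp) t
    + (-1) ^ m * (Rpower t (- INR m) * PSeries (alternating_exp_coef lm) t)).

Lemma besselN_INR m z lp lm Kp Km : 0 < z ->
  derivative_sequence (INR m + 1) lp Kp -> derivative_sequence (- INR m + 1) lm Km ->
  besselN (INR m) z = Rpower (z / 2) (INR m) * neumann_clifford m lp lm ((z / 2) ^ 2).
Proof.
move=> hz hp hm; rewrite /besselN.
have hfp : frac_part (INR m) = 0.
  by rewrite /frac_part Int_part_INR -INR_IZR_INZ; ring.
case: Req_EM_T => [_|//] /=.
set y := z / 2; set t := y ^ 2.
have hy : 0 < y by rewrite /y; lra.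
have dp := is_derive_clifford_order _ _ _ t hp.
have dm := is_derive_clifford_order _ _ _ t hm.
set E := PSeries (alternating_exp_coef lp) t in dp *.
set F := PSeries (alternating_exp_coef lm) t in dm *.
have hPI := PI_RGT_0.
have hs := sqr_pow_m1 m.
have h1 : Rpower y (INR m) * Rpower y (- INR m) = 1.
  by rewrite -Rpower_plus Rplus_opp_r Rpower_O.
have ht : t ^ m = Rpower y (INR m) ^ 2 by rewrite /t Rpower_pow // -!pow_mult Nat.mul_comm.
have lnt : ln t = 2 * ln y by rewrite /t /= Rmult_1_r ln_mult //; ring.
have hRt : Rpower t (- INR m) = Rpower y (- INR m) ^ 2.
  by rewrite /= Rmult_1_r Rpower_mult_distr //; congr Rpower; rewrite /t; ring.
pose f mu := besselJ mu z * cos (mu * PI) - besselJ (- mu) z.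
pose g mu := sin (mu * PI).
(* The numerator vanishes at m by [clifford_neg_INR]. In its derivative the terms in ln y coming
   from orders m and -m coincide up to the sign (-1)^m, hence the factor 2. *)
rewrite /neumann_quotient -/(f _) (@Lim_quotient_of_derive f g (INR m)
   ((-1) ^ m * (2 * ln y * Rpower y (INR m) * clifford (INR m) t
     + Rpower y (INR m) * E) + Rpower y (- INR m) * F) (PI * (-1) ^ m)).
- rewrite /= /neumann_clifford -/t -/E -/F lnt hRt.
  move: ((-1) ^ m) hs (Rpower y (INR m)) (Rpower y (- INR m)) h1 => s hs a b h1.
  have -> : a * (/ PI * (2 * ln y * clifford (INR m) t + E + s * (b ^ 2 * F))) =
    / PI * (a * (2 * ln y * clifford (INR m) t + E) + s * (a * b) * b * F) by ring.
  have hs0 : s <> 0 by move=> s0; rewrite s0 in hs; lra.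
  have -> : / PI = s / (PI * s) by field; lra.
  rewrite h1 /Rdiv; move: (/ (PI * s)) => q.
  have -> : s * q * (a * (2 * ln y * clifford (INR m) t + E) + s * 1 * b * F)
    = q * (s * (a * (2 * ln y * clifford (INR m) t + E)) + (s * s) * b * F) by ring.
  by rewrite hs; ring.
- rewrite /f !besselJE -/y -/t clifford_neg_INR cos_INR_PI ht.
  move: (Rpower y (INR m)) (Rpower y (- INR m)) h1 => a b h1.
  have -> : b * ((-1) ^ m * a ^ 2 * clifford (INR m) t)
    = (a * b) * a * (-1) ^ m * clifford (INR m) t by ring.
  by rewrite h1; ring.
- exact: sin_INR_PI.
- have := is_derive_neumann_numerator _ (ln y) _ _ _ dp dm.
  rewrite cos_INR_PI sin_INR_PI clifford_neg_INR -/(Rpower y (INR m)) -/(Rpower y (- INR m)) ht.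
  move: (Rpower y (INR m)) (Rpower y (- INR m)) h1 => a b h1.
  have -> : (ln y * a * clifford (INR m) t + a * E) * (-1) ^ m -
     a * clifford (INR m) t * (PI * 0) +
     (ln y * b * ((-1) ^ m * a ^ 2 * clifford (INR m) t) + b * F) =
     (-1) ^ m * ((1 + a * b) * ln y * a * clifford (INR m) t + a * E) + b * F by ring.
  by rewrite h1; replace (1 + 1) with 2 by ring.
- rewrite /g -(cos_INR_PI m); auto_derive => //; ring.
- by apply: Rmult_integral_contrapositive_currified; [lra | apply: pow_nonzero; lra].
Qed.

(** * The Bessel-Clifford equation *)

Ltac derive_side := repeat match goal with |- _ /\ _ => split end;
  first [done | lra | (eexists; eassumption)].

(** The derivative [y1] is a parameter because Wronskians mention it. A source [v] is allowed
    because the summands of [neumann_clifford] solve only inhomogeneous equations; their sources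
    cancel in the sum. *)
Definition clifford_equation (c : R) (v y y1 : R -> R) : Prop :=
  forall t, 0 < t -> is_derive y t (y1 t) /\
    exists y2 : R, is_derive y1 t y2 /\ t * y2 + c * y1 t + y t = v t.

Lemma clifford_equation_ext c v v' y y1 : (forall t, 0 < t -> v t = v' t) ->
  clifford_equation c v y y1 -> clifford_equation c v' y y1.
Proof.
by move=> hv h t ht; have [h1 [y2 h2]] := h t ht; split=> //; exists y2; rewrite -hv.
Qed.

Lemma clifford_equation_plus c v w y y1 z z1 :
  clifford_equation c v y y1 -> clifford_equation c w z z1 ->
  clifford_equation c (fun t => v t + w t) (fun t => y t + z t) (fun t => y1 t + z1 t).
Proof.
move=> hy hz t ht; have [h1 [y2 [h2 h3]]] := hy t ht; have [k1 [z2 [k2 k3]]] := hz t ht.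
split; first exact: (is_derive_plus y z).
exists (y2 + z2); split; first exact: (is_derive_plus y1 z1).
by rewrite -h3 -k3; ring.
Qed.

Lemma clifford_equation_scal c v y y1 a : clifford_equation c v y y1 ->
  clifford_equation c (fun t => a * v t) (fun t => a * y t) (fun t => a * y1 t).
Proof.
move=> hy t ht; have [h1 [y2 [h2 h3]]] := hy t ht.
split; first exact: (is_derive_scal y).
exists (a * y2); split; first exact: (is_derive_scal y1).
by rewrite -h3; ring.
Qed.

Lemma clifford_equation_PSeries a b c : factorially_bounded a ->
  (forall j, (INR j + 1) * (INR j + c) * a j.+1 + a j = b j) ->
  clifford_equation c (PSeries b) (PSeries a) (PSeries (PS_derive a)).
Proof.
move=> ha hab t ht; have ha1 := factorially_bounded_derive _ ha.
split; first exact: factorially_bounded_is_derive.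
exists (PSeries (PS_derive (PS_derive a)) t); split.
  exact: factorially_bounded_is_derive.
exact: PSeries_bessel_equation.
Qed.

Lemma is_derive_Rpower_mult nu (y : R -> R) t l : 0 < t -> is_derive y t l ->
  is_derive (fun t => Rpower t nu * y t) t (Rpower t nu * (l + nu / t * y t)).
Proof.
move=> ht hy; rewrite /Rpower; auto_derive; first by derive_side.
by rewrite (is_derive_unique _ _ _ hy); field; lra.
Qed.

(** For c = 1 - nu the exponents at t = 0 are 0 and nu; multiplication by t^(-nu) turns them into
    -nu and 0, the exponents for c = nu + 1. *)
Lemma clifford_equation_Rpower nu v y y1 : clifford_equation (1 - nu) v y y1 ->
  clifford_equation (nu + 1) (fun t => Rpower t (- nu) * v t)
    (fun t => Rpower t (- nu) * y t) (fun t => Rpower t (- nu) * (y1 t + - nu / t * y t)).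
Proof.
move=> hy t ht; have [h1 [y2 [h2 h3]]] := hy t ht.
split; first exact: is_derive_Rpower_mult.
pose q t := y1 t + - nu / t * y t.
have hq : is_derive q t (y2 + nu / t ^ 2 * y t - nu / t * y1 t).
  rewrite /q; auto_derive; first by derive_side.
  by rewrite (is_derive_unique _ _ _ h1) (is_derive_unique _ _ _ h2); field; lra.
eexists; split; first exact: (is_derive_Rpower_mult _ q _ _ ht hq).
by rewrite -h3 /q; field; lra.
Qed.

Lemma clifford_equation_ln c y y1 : clifford_equation c (fun _ => 0) y y1 ->
  clifford_equation c (fun t => 2 * y1 t + (c - 1) * y t / t)
    (fun t => ln t * y t) (fun t => y t / t + ln t * y1 t).
Proof.
move=> hy t ht; have [h1 [y2 [h2 h3]]] := hy t ht.
split.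
  auto_derive; first by derive_side.
  by rewrite (is_derive_unique _ _ _ h1); field; lra.
exists (2 * y1 t / t - y t / t ^ 2 + ln t * y2); split.
  auto_derive; first by derive_side.
  by rewrite (is_derive_unique _ _ _ h1) (is_derive_unique _ _ _ h2); field; lra.
have -> : y t = - (t * y2 + c * y1 t) by lra.
by field; lra.
Qed.

(** Abel's identity: the equations give t W' + c W = 0, so t^c W has derivative zero on the
    half-line and equals its value at 1. *)
Lemma wronskian_const c y y1 w w1 :
  clifford_equation c (fun _ => 0) y y1 -> clifford_equation c (fun _ => 0) w w1 ->
  forall t, 0 < t -> Rpower t c * (y t * w1 t - y1 t * w t) = y 1 * w1 1 - y1 1 * w 1.
Proof.
move=> hy hw.
pose f t := Rpower t c * (y t * w1 t - y1 t * w t).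
have hf t : 0 < t -> is_derive f t 0.
  move=> ht; have [h1 [y2 [h2 h3]]] := hy t ht; have [k1 [w2 [k2 k3]]] := hw t ht.
  have hW : is_derive (fun t => y t * w1 t - y1 t * w t) t (y t * w2 - y2 * w t).
    auto_derive; first by derive_side.
    rewrite (is_derive_unique _ _ _ h1) (is_derive_unique _ _ _ h2).
    by rewrite (is_derive_unique _ _ _ k1) (is_derive_unique _ _ _ k2); ring.
  have := is_derive_Rpower_mult c _ t _ ht hW.
  rewrite -/f; set l := Rpower t c * _; suff -> : l = 0 by [].
  rewrite /l; suff -> : y t * w2 - y2 * w t + c / t * (y t * w1 t - y1 t * w t) = 0 by ring.
  have -> : y2 = - (c * y1 t + y t) / t by field_simplify_eq; lra.
  have -> : w2 = - (c * w1 t + w t) / t by field_simplify_eq; lra.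
  by field; lra.
have f1 : f 1 = y 1 * w1 1 - y1 1 * w 1 by rewrite /f /Rpower ln_1 Rmult_0_r exp_0; ring.
move=> t ht; rewrite -f1 -/(f t).
case: (Rtotal_order t 1) => [h|[->//|h]].
  by apply: (eq_is_derive f) => // s hs; apply: hf; lra.
by apply: esym; apply: (eq_is_derive f) => // s hs; apply: hf; lra.
Qed.

(** Cramer's rule: W(g,w) y = W(y,w) g + W(g,y) w holds identically, and all three Wronskians are
    constants times the same power of t. *)
Lemma clifford_equation_span c g g1 w w1 t0 :
  clifford_equation c (fun _ => 0) g g1 -> clifford_equation c (fun _ => 0) w w1 ->
  0 < t0 -> g t0 * w1 t0 - g1 t0 * w t0 <> 0 ->
  forall y y1, clifford_equation c (fun _ => 0) y y1 ->
  exists a b, forall t, 0 < t -> y t = a * g t + b * w t.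
Proof.
move=> hg hw ht0 hW y y1 hy.
have kgw := wronskian_const _ _ _ _ _ hg hw.
have kyw := wronskian_const _ _ _ _ _ hy hw.
have kgy := wronskian_const _ _ _ _ _ hg hy.
move: (g 1 * w1 1 - _) (y 1 * w1 1 - _) (g 1 * y1 1 - _) kgw kyw kgy => k a b kgw kyw kgy.
have hk : k <> 0.
  rewrite -(kgw t0 ht0); apply: Rmult_integral_contrapositive_currified => //.
  by have := exp_pos (c * ln t0); rewrite /Rpower; lra.
exists (a / k), (b / k) => t ht.
apply: (Rmult_eq_reg_r k) => //.
rewrite Rmult_plus_distr_r.
replace (a / k * g t * k) with (a * g t) by (field; exact: hk).
replace (b / k * w t * k) with (b * w t) by (field; exact: hk).
by rewrite -(kgw t ht) -(kyw t ht) -(kgy t ht); ring.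
Qed.

(** Carries a value computed at t = 0, where the second solution may be singular, to some t > 0
    where the Wronskian makes sense. *)
Lemma continuous_neq0_pos f : continuity_pt f 0 -> f 0 <> 0 -> exists t, 0 < t /\ f t <> 0.
Proof.
move=> hf h0; have [d [hd hfd]] := hf _ (Rabs_pos_lt _ h0).
exists (d / 2); split; first lra.
move=> e; have : Rabs (f (d / 2) - f 0) < Rabs (f 0); last first.
  by rewrite e Rminus_0_l Rabs_Ropp; lra.
apply: (hfd (d / 2)); split; first by split => //; lra.
by rewrite /= /Rdist Rminus_0_r Rabs_pos_eq; lra.
Qed.

Lemma rgamma_neq0 x : (forall j, x + INR j <> 0) -> rgamma x <> 0.
Proof.
have key N : forall x, 0 < x + INR N -> (forall j, x + INR j <> 0) -> rgamma x <> 0.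
  elim: N => [|N IHN] {}x hx hj.
    by have := rgamma_pos x; rewrite /= in hx; lra.
  rewrite rgamma_rec; apply: Rmult_integral_contrapositive_currified.
    by have := hj 0%N; rewrite /= Rplus_0_r.
  apply: IHN => [|j]; first by rewrite S_INR in hx; lra.
  by have := hj j.+1; rewrite S_INR; lra.
move=> hj; have [N hN] := INR_unbounded (Rabs x + 1).
have h1 := Rle_abs (- x); rewrite Rabs_Ropp in h1.
by apply: (key N) => //; lra.
Qed.

Definition fundamental_system (nu : R) (w : R -> R) : Prop :=
  exists g1 w1,
    clifford_equation (nu + 1) (fun _ => 0) (clifford nu) g1 /\
    clifford_equation (nu + 1) (fun _ => 0) w w1 /\
    exists t, 0 < t /\ clifford nu t * w1 t - g1 t * w t <> 0.

Definition clifford1 (nu : R) : R -> R := PSeries (PS_derive (clifford_coef nu)).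

Lemma clifford_equation_clifford nu :
  clifford_equation (nu + 1) (fun _ => 0) (clifford nu) (clifford1 nu).
Proof.
apply: clifford_equation_ext
  (clifford_equation_PSeries _ (fun _ => 0) _ (clifford_coef_bounded nu) (clifford_coef_rec nu)).
by move=> t _; exact: PSeries_const_0.
Qed.

Lemma PSeries_continuity a x : factorially_bounded a -> continuity_pt (PSeries a) x.
Proof.
move=> ha; apply: derivable_continuous_pt.
exists (PSeries (PS_derive a) x); apply/is_derive_Reals.
exact: factorially_bounded_is_derive.
Qed.

Lemma fundamental_system_nonint nu :
  (forall j, nu + 1 + INR j <> 0) -> (forall j, - nu + 1 + INR j <> 0) -> nu <> 0 ->
  fundamental_system nu (fun t => Rpower t (- nu) * clifford (- nu) t).
Proof.
move=> hp hm h0.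
exists (clifford1 nu), (fun t => Rpower t (- nu) * (clifford1 (- nu) t + - nu / t * clifford (- nu) t)).
split; first exact: clifford_equation_clifford.
split.
  apply: (@clifford_equation_ext _ (fun t => Rpower t (- nu) * 0)); first by move=> *; ring.
  apply: clifford_equation_Rpower.
  have -> : 1 - nu = - nu + 1 by ring.
  exact: clifford_equation_clifford.
(* This is t^(nu+1) times the Wronskian, with value -nu / (Gamma(1 + nu) Gamma(1 - nu)) at t = 0. *)
pose f t := - nu * clifford nu t * clifford (- nu) t
  + t * (clifford nu t * clifford1 (- nu) t - clifford1 nu t * clifford (- nu) t).
have hf : continuity_pt f 0.
  have c0 mu := PSeries_continuity _ 0 (clifford_coef_bounded mu).
  have c1 mu := PSeries_continuity _ 0 (factorially_bounded_derive _ (clifford_coef_bounded mu)).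
  have cid : continuity_pt (fun t => t) 0 by apply: continuity_pt_id.
  have ccst : continuity_pt (fun _ => - nu) 0 by apply: continuity_pt_const.
  apply: continuity_pt_plus.
    by apply: continuity_pt_mult (c0 _); apply: continuity_pt_mult (c0 _).
  apply: continuity_pt_mult => //; apply: continuity_pt_minus.
    by apply: continuity_pt_mult (c1 _); exact: c0.
  by apply: continuity_pt_mult (c0 _); exact: c1.
have [|t [ht htf]] := continuous_neq0_pos f hf.
  rewrite /f !clifford_0 Rmult_0_l Rplus_0_r.
  have := rgamma_neq0 _ hp; have := rgamma_neq0 _ hm => g1 g2.
  do !apply: Rmult_integral_contrapositive_currified => //; lra.
exists t; split => // e; apply: htf.
have hR : Rpower t (- nu) <> 0 by have := exp_pos (- nu * ln t); rewrite /Rpower; lra.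
apply: (Rmult_eq_reg_r (Rpower t (- nu))) => //.
rewrite Rmult_0_l -(Rmult_0_r t) -e /f; field; lra.
Qed.

(** Obtained by differentiating both sides of t^(-m) C_(-m)(t) = (-1)^m C_m(t). It rewrites the
    source coming from order -m in terms of order m. *)
Lemma clifford1_neg_INR m t : 0 < t ->
  Rpower t (- INR m) * clifford1 (- INR m) t
  = (-1) ^ m * (clifford1 (INR m) t + INR m / t * clifford (INR m) t).
Proof.
move=> ht.
have d1 : is_derive (fun t => Rpower t (- INR m) * clifford (- INR m) t) t
  (Rpower t (- INR m) * (clifford1 (- INR m) t + - INR m / t * clifford (- INR m) t)).
  apply: is_derive_Rpower_mult => //.
  exact: factorially_bounded_is_derive (clifford_coef_bounded _).
have d2 : is_derive (fun t => (-1) ^ m * clifford (INR m) t) t ((-1) ^ m * clifford1 (INR m) t).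
  apply: (is_derive_scal (clifford (INR m))).
  exact: factorially_bounded_is_derive (clifford_coef_bounded _).
have e s : 0 < s -> Rpower s (- INR m) * clifford (- INR m) s = (-1) ^ m * clifford (INR m) s.
  move=> hs; rewrite clifford_neg_INR -(Rpower_pow m s) //.
  have h : Rpower s (- INR m) * Rpower s (INR m) = 1.
    by rewrite -Rpower_plus Rplus_opp_l Rpower_O.
  rewrite -(Rmult_1_l ((-1) ^ m * clifford (INR m) s)) -h; ring.
have d3 : is_derive (fun t => (-1) ^ m * clifford (INR m) t) t
  (Rpower t (- INR m) * (clifford1 (- INR m) t + - INR m / t * clifford (- INR m) t)).
  apply: is_derive_ext_loc d1; exists (mkposreal t ht) => s hs.
  apply: e; move: hs; rewrite /ball /= /AbsRing_ball /abs /minus /plus /opp /=.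
  by rewrite /Rabs; case: Rcase_abs; lra.
have := is_derive_unique _ _ _ d3; rewrite (is_derive_unique _ _ _ d2) => h.
have := e t ht => h2.
rewrite Rmult_plus_distr_l h.
have -> : (-1) ^ m * (INR m / t * clifford (INR m) t)
  = INR m / t * ((-1) ^ m * clifford (INR m) t) by ring.
by rewrite -h2; field; lra.
Qed.

Lemma fundamental_system_INR m lp lm Kp Km :
  derivative_sequence (INR m + 1) lp Kp -> derivative_sequence (- INR m + 1) lm Km ->
  fundamental_system (INR m) (neumann_clifford m lp lm).
Proof.
move=> hlp hlm; have hs := sqr_pow_m1 m; have hPI := PI_RGT_0.
set a := alternating_exp_coef lp; set b := alternating_exp_coef lm.
have ba : factorially_bounded a by apply: (@alternating_exp_coef_bounded _ Kp); apply hlp.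
have bb : factorially_bounded b by apply: (@alternating_exp_coef_bounded _ Km); apply hlm.
pose E1 := PSeries (PS_derive a); pose F1 := PSeries (PS_derive b).
exists (clifford1 (INR m)), (fun t => / PI * (clifford (INR m) t / t
  + ln t * clifford1 (INR m) t + E1 t
  + (-1) ^ m * (Rpower t (- INR m) * (F1 t + - INR m / t * PSeries b t)))).
have hC := clifford_equation_clifford (INR m).
split=> //; split.
  have hE : clifford_equation (INR m + 1)
    (PSeries (fun j => - PS_derive (clifford_coef (INR m)) j)) (PSeries a) E1.
    by apply: clifford_equation_PSeries ba _ => j; apply: derivative_coef_rec hlp.
  have hF : clifford_equation (1 - INR m)
    (PSeries (fun j => - PS_derive (clifford_coef (- INR m)) j)) (PSeries b) F1.
    apply: clifford_equation_PSeries bb _ => j.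
    have -> : 1 - INR m = - INR m + 1 by ring.
    exact: derivative_coef_rec hlm.
  (* With C = C_m, the three sources are 2 C' + m C / t from the logarithm, -C' from order m, and
     -(C' + m C / t) from order -m; they sum to zero. *)
  have := clifford_equation_scal _ _ _ _ (/ PI)
    (clifford_equation_plus _ _ _ _ _ _ _
      (clifford_equation_plus _ _ _ _ _ _ _ (clifford_equation_ln _ _ _ hC) hE)
      (clifford_equation_scal _ _ _ _ ((-1) ^ m) (clifford_equation_Rpower _ _ _ _ hF))).
  apply: clifford_equation_ext => t ht.
  have hopp c : PSeries (fun j => - c j) t = - PSeries c t by exact: PSeries_opp.
  rewrite !hopp -/(clifford1 (INR m) t) -/(clifford1 (- INR m) t) -Ropp_mult_distr_r.
  rewrite clifford1_neg_INR //.
  have -> : (-1) ^ m * - ((-1) ^ m * (clifford1 (INR m) t + INR m / t * clifford (INR m) t))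
    = - (((-1) ^ m * (-1) ^ m) * (clifford1 (INR m) t + INR m / t * clifford (INR m) t)) by ring.
  by rewrite hs; field; lra.
pose C := clifford (INR m); pose C1 := clifford1 (INR m).
(* This is PI t^(m+1) times the Wronskian, in which the logarithms cancel. At t = 0 it equals 1 if m
   = 0; otherwise it is -(-1)^m m C(0) [lm 0], where [lm 0] is the slope of 1/Gamma at its simple
   zero 1 - m. *)
pose f t := t ^ m * (C t * C t + t * (C t * E1 t - C1 t * PSeries a t))
  + (-1) ^ m * (- INR m * (C t * PSeries b t) + t * (C t * F1 t - C1 t * PSeries b t)).
have hf : continuity_pt f 0.
  have c0 := PSeries_continuity _ 0 (clifford_coef_bounded (INR m)).
  have c1 := PSeries_continuity _ 0 (factorially_bounded_derive _ (clifford_coef_bounded (INR m))).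
  have ca := PSeries_continuity _ 0 ba; have cb := PSeries_continuity _ 0 bb.
  have ca1 := PSeries_continuity _ 0 (factorially_bounded_derive _ ba).
  have cb1 := PSeries_continuity _ 0 (factorially_bounded_derive _ bb).
  have cid : continuity_pt (fun t => t) 0 by apply: continuity_pt_id.
  have ccst k : continuity_pt (fun _ => k) 0 by apply: continuity_pt_const.
  have cpow : continuity_pt (fun t => t ^ m) 0.
    by apply: derivable_continuous_pt; apply: derivable_pt_pow.
  by repeat first [ by [] | apply: continuity_pt_minus | apply: continuity_pt_plus
    | apply: continuity_pt_mult ].
have [|t [ht htf]] := continuous_neq0_pos f hf.
  have hb0 : PSeries b 0 = lm 0%N.
    by rewrite PSeries_0 /b /alternating_exp_coef /=; field.
  rewrite /f /C clifford_0 hb0 !Rmult_0_l !Rplus_0_r.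
  have g0 : rgamma (INR m + 1) <> 0.
    by have := rgamma_pos (INR m + 1); have := pos_INR m; lra.
  case: (m) hlm g0 => [|i] hl g0.
    rewrite /= Rplus_0_l rgamma_1; lra.
  rewrite pow_i; last lia.
  rewrite Rmult_0_l Rplus_0_l.
  have hl0 : lm 0%N <> 0.
    apply: (@derivative_sequence_head_neq0 i _ Km).
    by have -> : - INR i = - INR i.+1 + 1 by rewrite S_INR; ring.
  apply: Rmult_integral_contrapositive_currified; first by apply: pow_nonzero; lra.
  apply: Rmult_integral_contrapositive_currified.
    by rewrite S_INR; have := pos_INR i; lra.
  exact: Rmult_integral_contrapositive_currified.
exists t; split => // e; apply: htf.
have hR : Rpower t (INR m) * Rpower t (- INR m) = 1.
  by rewrite -Rpower_plus Rplus_opp_r Rpower_O.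
rewrite /f -(Rpower_pow m t) // -(Rmult_0_r (PI * t * Rpower t (INR m))) -e.
rewrite /neumann_clifford -/a -/b -/(C t) -/(C1 t).
have -> : (-1) ^ m * (- INR m * (C t * PSeries b t) + t * (C t * F1 t - C1 t * PSeries b t))
  = (Rpower t (INR m) * Rpower t (- INR m)) *
    ((-1) ^ m * (- INR m * (C t * PSeries b t) + t * (C t * F1 t - C1 t * PSeries b t))).
  by rewrite hR; ring.
by field; lra.
Qed.

(** At a half-integer order cos (nu PI) = 0, so N_nu reduces to -J_(-nu) / sin (nu PI). *)
Lemma besselN_half p z : 0 < z ->
  let nu := INR p - 1/2 in
  besselN nu z = Rpower (z / 2) nu *
    (- / sin (nu * PI) * (Rpower ((z / 2) ^ 2) (- nu) * clifford (- nu) ((z / 2) ^ 2))).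
Proof.
move=> hz nu; rewrite /besselN.
have hfp : frac_part nu <> 0.
  move=> /fp_nat [k hk].
  have : IZR (2 * Z.of_nat p - 1) = IZR (2 * k).
    by rewrite minus_IZR !mult_IZR -hk -INR_IZR_INZ /nu; field.
  by move/eq_IZR; lia.
case: Req_EM_T => [//|_] /=.
have hcos : cos (nu * PI) = 0.
  have -> : nu * PI = INR p * PI - PI / 2 by rewrite /nu; field.
  by rewrite cos_minus sin_INR_PI cos_PI2; ring.
rewrite /neumann_quotient hcos (besselJE (- nu)) Rmult_0_r Rminus_0_l.
have hy : 0 < z / 2 by lra.
set y := z / 2 in hy *.
have e : Rpower (y ^ 2) (- nu) * Rpower y nu = Rpower y (- nu).
  have -> : y ^ 2 = y * y by ring.
  rewrite -Rpower_mult_distr // Rmult_assoc -Rpower_plus Rplus_opp_l Rpower_O //; ring.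
by rewrite -[y * (y * 1)]/(y ^ 2) -e /Rdiv; ring.
Qed.

Lemma fundamental_system_scal nu w k : k <> 0 ->
  fundamental_system nu w -> fundamental_system nu (fun t => k * w t).
Proof.
move=> hk [g1 [w1 [hg [hw [t [ht hW]]]]]].
exists g1, (fun t => k * w1 t); split => //; split.
  apply: (@clifford_equation_ext _ (fun t => k * 0)); first by move=> *; ring.
  exact: clifford_equation_scal.
exists t; split => //.
have -> : clifford nu t * (k * w1 t) - g1 t * (k * w t)
  = k * (clifford nu t * w1 t - g1 t * w t) by ring.
exact: Rmult_integral_contrapositive_currified.
Qed.

Lemma fundamental_system_half p : let nu := INR p - 1/2 in
  fundamental_system nu
    (fun t => - / sin (nu * PI) * (Rpower t (- nu) * clifford (- nu) t)).
Proof.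
move=> nu; have hnz (k : Z) : IZR k <> 1/2.
  move=> h; have : IZR (2 * k) = IZR 1 by rewrite mult_IZR h; field.
  by move/eq_IZR; lia.
apply: fundamental_system_scal.
  apply: Ropp_neq_0_compat; apply: Rinv_neq_0_compat.
  have -> : nu * PI = INR p * PI - PI / 2 by rewrite /nu; field.
  rewrite sin_minus sin_INR_PI cos_INR_PI cos_PI2 sin_PI2.
  by have := pow_nonzero (-1) p; lra.
apply: fundamental_system_nonint => [j|j|].
- by have := pos_INR p; have := pos_INR j; rewrite /nu; lra.
- move=> h; apply: (hnz (Z.of_nat p - 1 - Z.of_nat j)%Z).
  by rewrite !minus_IZR -!INR_IZR_INZ; rewrite /nu in h; lra.
- by move=> h; apply: (hnz (Z.of_nat p)); rewrite -INR_IZR_INZ; rewrite /nu in h; lra.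
Qed.

Lemma besselN_fundamental_system d n : (1 <= d)%N ->
  let nu := INR n + INR d / 2 - 1 in
  exists w, fundamental_system nu w /\
    forall z, 0 < z -> besselN nu z = Rpower (z / 2) nu * w ((z / 2) ^ 2).
Proof.
move=> hd nu.
have := odd_double_half d; case: (odd d) => /= hdd.
  have -> : nu = INR (n + d./2) - 1/2.
    by rewrite /nu -{1}hdd -addnn !plus_INR /=; field.
  eexists; split; first exact: fundamental_system_half.
  by move=> z hz; exact: besselN_half.
(* An even d >= 1 is at least 2, so the truncated predecessor of d/2 below is the true d/2 - 1. *)
have hd2 : (0 < d./2)%N by rewrite half_gt0; case: (d) hd hdd => [|[|]].
have -> : nu = INR (n + d./2.-1).
  rewrite /nu -{1}hdd add0n -addnn -{1 2}(prednK hd2) !plus_INR !S_INR; field.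
have [lp [Kp hp]] := derivative_sequence_pos (n + d./2.-1).
have [lm [Km hm]] := derivative_sequence_neg (n + d./2.-1).
exists (neumann_clifford (n + d./2.-1) lp lm); split.
  exact: fundamental_system_INR hp hm.
by move=> z hz; exact: besselN_INR hz hp hm.
Qed.

(** * Complex derivatives and homogeneous polynomials *)

Lemma is_derive_RC_fst f t l : is_derive_RC f t l ->
  is_derive (fun s => fst (f s)) t (fst l).
Proof.
move=> h.
apply: filterdiff_ext_lin (@filterdiff_comp' R_AbsRing R_NormedModule C_R_NormedModule
  R_NormedModule f fst t _ _ h (filterdiff_linear _ is_linear_fst)) _ => y.
by [].
Qed.

Lemma is_derive_RC_snd f t l : is_derive_RC f t l ->
  is_derive (fun s => snd (f s)) t (snd l).
Proof.
move=> h.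
apply: filterdiff_ext_lin (@filterdiff_comp' R_AbsRing R_NormedModule C_R_NormedModule
  R_NormedModule f snd t _ _ h (filterdiff_linear _ is_linear_snd)) _ => y.
by [].
Qed.

Lemma is_derive_RC_pair f t l : is_derive (fun s => fst (f s)) t (fst l) ->
  is_derive (fun s => snd (f s)) t (snd l) -> is_derive_RC f t l.
Proof.
move=> h1 h2.
have k1 := @is_derive_scal_l R_AbsRing C_R_NormedModule _ _ _ (RtoC 1) h1.
have k2 := @is_derive_scal_l R_AbsRing C_R_NormedModule _ _ _ Ci h2.
have := @is_derive_plus R_AbsRing C_R_NormedModule _ _ _ _ _ k1 k2.
have e z : plus (scal (fst z) (RtoC 1 : C_R_NormedModule)) (scal (snd z) (Ci : C_R_NormedModule)) = z.
  case: z => a b; rewrite /plus /scal /= /prod_plus /prod_scal /scal /= /mult /plus /=.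
  by congr pair; ring.
rewrite e; apply: is_derive_ext => s; exact: e.
Qed.

Lemma is_derive_RC_unique f t l l' : is_derive_RC f t l -> is_derive_RC f t l' -> l = l'.
Proof.
move=> h h'; rewrite (surjective_pairing l) (surjective_pairing l'); congr pair.
  by rewrite -(is_derive_unique _ _ _ (is_derive_RC_fst _ _ _ h));
     apply: is_derive_unique; exact: is_derive_RC_fst h'.
by rewrite -(is_derive_unique _ _ _ (is_derive_RC_snd _ _ _ h));
   apply: is_derive_unique; exact: is_derive_RC_snd h'.
Qed.

Lemma is_derive_RC_plus f g t a b : is_derive_RC f t a -> is_derive_RC g t b ->
  is_derive_RC (fun s => f s + g s)%C t (a + b)%C.
Proof. exact: (@is_derive_plus R_AbsRing C_R_NormedModule). Qed.

Lemma is_derive_RC_const (z : C) t : is_derive_RC (fun _ => z) t (RtoC 0).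
Proof. exact: (@is_derive_const R_AbsRing C_R_NormedModule). Qed.

Lemma is_derive_RC_mult f g t a b : is_derive_RC f t a -> is_derive_RC g t b ->
  is_derive_RC (fun s => f s * g s)%C t (a * g t + f t * b)%C.
Proof.
move=> hf hg.
have f1 := is_derive_RC_fst _ _ _ hf; have f2 := is_derive_RC_snd _ _ _ hf.
have g1 := is_derive_RC_fst _ _ _ hg; have g2 := is_derive_RC_snd _ _ _ hg.
(* One real computation serves both components of the complex product: [e] is -1 for the real part
   and 1 for the imaginary part. *)
have hmul (u v w z : R -> R) (u' v' w' z' e : R) : is_derive u t u' -> is_derive v t v' ->
    is_derive w t w' -> is_derive z t z' ->
    is_derive (fun s => u s * v s + e * (w s * z s)) t
      (u' * v t + u t * v' + e * (w' * z t + w t * z')).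
  move=> hu hv hw hz; auto_derive; first by derive_side.
  rewrite (is_derive_unique _ _ _ hu) (is_derive_unique _ _ _ hv).
  by rewrite (is_derive_unique _ _ _ hw) (is_derive_unique _ _ _ hz); ring.
apply: is_derive_RC_pair.
  have := hmul _ _ _ _ _ _ _ _ (-1) f1 g1 f2 g2.
  have -> : fst a * fst (g t) + fst (f t) * fst b + -1 * (snd a * snd (g t) + snd (f t) * snd b)
    = fst (a * g t + f t * b)%C by rewrite /=; ring.
  by apply: is_derive_ext => s /=; ring.
have := hmul _ _ _ _ _ _ _ _ 1 f1 g2 f2 g1.
have -> : fst a * snd (g t) + fst (f t) * snd b + 1 * (snd a * fst (g t) + snd (f t) * fst b)
  = snd (a * g t + f t * b)%C by rewrite /=; ring.
by apply: is_derive_ext => s /=; ring.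
Qed.

Lemma is_derive_RC_RtoC (f : R -> R) t (l : R) : is_derive f t l ->
  is_derive_RC (fun s => RtoC (f s)) t (RtoC l).
Proof. by move=> h; apply: is_derive_RC_pair => //=; exact: is_derive_const. Qed.

Lemma is_derive_RC_comp f (g : R -> R) t df dg : is_derive_RC f (g t) df -> is_derive g t dg ->
  is_derive_RC (fun s => f (g s)) t (RtoC dg * df)%C.
Proof.
move=> hf hg.
have -> : (RtoC dg * df)%C = scal dg (df : C_R_NormedModule).
  case: df hf => x y _; rewrite /scal /= /prod_scal /scal /= /mult /=.
  by rewrite /Cmult /=; congr pair; ring.
exact: (@is_derive_comp R_AbsRing C_R_NormedModule).
Qed.

Lemma is_derive_RC_eq f t l l' : is_derive_RC f t l -> l = l' -> is_derive_RC f t l'.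
Proof. by move=> h <-. Qed.

Lemma is_derive_RC_sum I (r : seq I) (p : pred I) (f : I -> R -> C) (l : I -> C) t :
  (forall i, is_derive_RC (f i) t (l i)) ->
  is_derive_RC (fun s => \big[Cplus/RtoC 0]_(i <- r | p i) f i s) t
    (\big[Cplus/RtoC 0]_(i <- r | p i) l i).
Proof.
move=> h; elim: r => [|i r IHr].
  rewrite big_nil; apply: is_derive_ext (is_derive_RC_const (RtoC 0) t) => s.
  by rewrite big_nil.
rewrite big_cons; case hp : (p i).
  apply: is_derive_ext (is_derive_RC_plus _ _ _ _ _ (h i) IHr) => s.
  by rewrite big_cons hp.
by apply: is_derive_ext IHr => s; rewrite big_cons hp.
Qed.

Lemma Cmult_sumr I (r : seq I) (p : pred I) (f : I -> C) z :
  (z * \big[Cplus/RtoC 0]_(i <- r | p i) f i)%C = \big[Cplus/RtoC 0]_(i <- r | p i) (z * f i)%C.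
Proof.
apply: (big_morph (Cmult z)) => [x y|]; [exact: Cmult_plus_distr_l | exact: Cmult_0_r].
Qed.

Lemma RtoC_sum I (r : seq I) (p : pred I) (f : I -> R) :
  RtoC (\big[Rplus/0]_(i <- r | p i) f i) = \big[Cplus/RtoC 0]_(i <- r | p i) RtoC (f i).
Proof. by apply: (big_morph RtoC) => [x y|//]; exact: RtoC_plus. Qed.

Lemma Csum_const d (z : C) : \big[Cplus/RtoC 0]_(i < d) z = (RtoC (INR d) * z)%C.
Proof.
rewrite big_const_ord; elim: d => [|d IHd]; first by rewrite /= Cmult_0_l.
by rewrite iterS IHd S_INR RtoC_plus; ring.
Qed.

Definition monomial d m (x : pt d) (a : 'I_d -> 'I_m) : R :=
  \big[Rmult/1]_(i < d) (x i ^ a i).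

(** For exponent 0 the truncated predecessor is harmless: the factor [INR (a i)] vanishes. *)
Definition partial_monomial d m (i : 'I_d) (x : pt d) (a : 'I_d -> 'I_m) : R :=
  INR (a i) * x i ^ (a i).-1 * \big[Rmult/1]_(j < d | j != i) (x j ^ a j).

Lemma upd_same d (x : pt d) i t : upd x i t i = t.
Proof. by rewrite /upd eqxx. Qed.

Lemma upd_other d (x : pt d) i t j : j != i -> upd x i t j = x j.
Proof. by rewrite /upd => /negbTE ->. Qed.

Lemma upd_id d (x : pt d) i : upd x i (x i) = x.
Proof.
apply: functional_extensionality => j.
by rewrite /upd; case: eqP => [->|].
Qed.

Lemma monomial_upd d m (x : pt d) (a : 'I_d -> 'I_m) i t :
  monomial _ _ (upd x i t) a = t ^ a i * \big[Rmult/1]_(j < d | j != i) (x j ^ a j).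
Proof.
rewrite /monomial (bigD1 i) //= upd_same; congr (_ * _).
by apply: eq_bigr => j hj; rewrite upd_other.
Qed.

Lemma is_derive_monomial d m (x : pt d) (a : 'I_d -> 'I_m) i t :
  is_derive (fun s => monomial _ _ (upd x i s) a) t (partial_monomial _ _ i (upd x i t) a).
Proof.
apply: (is_derive_ext (fun s => s ^ a i * \big[Rmult/1]_(j < d | j != i) (x j ^ a j))).
  by move=> s; rewrite monomial_upd.
rewrite /partial_monomial upd_same.
have -> : \big[Rmult/1]_(j < d | j != i) (upd x i t j ^ a j) =
    \big[Rmult/1]_(j < d | j != i) (x j ^ a j).
  by apply: eq_bigr => j hj; rewrite upd_other.
by auto_derive => //; rewrite Rmult_1_l.
Qed.

Lemma euler_monomial d m (x : pt d) (a : 'I_d -> 'I_m) :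
  \big[Rplus/0]_(i < d) (x i * partial_monomial _ _ i x a)
  = INR (\sum_(i < d) a i) * monomial _ _ x a.
Proof.
rewrite (big_morph INR (id1 := 0) (op1 := Rplus) plus_INR) //.
rewrite Rmult_comm (big_morph (Rmult (monomial _ _ x a)) (id1 := 0) (op1 := Rplus)) => //;
  [|exact: Rmult_plus_distr_l | exact: Rmult_0_r].
apply: eq_bigr => i _.
have -> : monomial _ _ x a = x i ^ a i * \big[Rmult/1]_(j < d | j != i) (x j ^ a j).
  by rewrite /monomial (bigD1 i).
rewrite /partial_monomial; move: (\big[_/_]_(j < d | _) _) => B.
by case: (nat_of_ord (a i)) => [|k]; [rewrite [INR 0]/= | rewrite -tech_pow_Rmult [k.+1.-1]/=]; ring.
Qed.

Lemma monomial_scal d m (x : pt d) (a : 'I_d -> 'I_m) r :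
  monomial _ _ (fun i => r * x i) a = r ^ (\sum_(i < d) a i) * monomial _ _ x a.
Proof.
rewrite /monomial (eq_bigr (fun i => r ^ a i * x i ^ a i)) => [|i _]; last exact: Rpow_mult_distr.
rewrite big_split /=; congr (_ * _).
by rewrite (big_morph (pow r) (id1 := 1) (op1 := Rmult) (pow_add r)).
Qed.

(* The second clause is Euler's identity. *)
Lemma homogeneous_polynomial_partials d n (P : pt d -> C) : homogeneous_polynomial n P ->
  exists DP : 'I_d -> pt d -> C,
    (forall i x t, is_derive_RC (fun s => P (upd x i s)) t (DP i (upd x i t))) /\
    (forall x, \big[Cplus/RtoC 0]_(i < d) (RtoC (x i) * DP i x)%C = (RtoC (INR n) * P x)%C) /\
    (forall r x, P (fun i => r * x i) = (RtoC (r ^ n) * P x)%C).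
Proof.
move=> [c hc].
have hP x : P x = \big[Cplus/RtoC 0]_(a : {ffun 'I_d -> 'I_n.+1} |
   (\sum_(i < d) a i)%N == n) (c a * RtoC (monomial _ _ x a))%C by exact: hc.
exists (fun i x => \big[Cplus/RtoC 0]_(a : {ffun 'I_d -> 'I_n.+1} |
   (\sum_(i < d) a i)%N == n) (c a * RtoC (partial_monomial _ _ i x a))%C).
split; [|split] => [i x t|x|r x].
- apply: is_derive_ext => [s|]; first by rewrite hP.
  apply: is_derive_RC_sum => a.
  apply: is_derive_RC_eq (is_derive_RC_mult _ _ _ _ _ (is_derive_RC_const (c a) t)
    (is_derive_RC_RtoC _ _ _ (is_derive_monomial _ _ x a i t))) _.
  by rewrite Cmult_0_l Cplus_0_l.
- rewrite (eq_bigr (fun i => \big[Cplus/RtoC 0]_(a : {ffun 'I_d -> 'I_n.+1} |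
    (\sum_(i < d) a i)%N == n) (RtoC (x i) * (c a * RtoC (partial_monomial _ _ i x a)))%C))
    => [|i _]; last by rewrite Cmult_sumr.
  rewrite exchange_big hP Cmult_sumr; apply: eq_bigr => a /eqP ha.
  transitivity (\big[Cplus/RtoC 0]_(i < d)
      (c a * RtoC (x i * partial_monomial _ _ i x a))%C).
    by apply: eq_bigr => i _; rewrite RtoC_mult !Cmult_assoc (Cmult_comm (RtoC (x i))).
  rewrite -Cmult_sumr -RtoC_sum euler_monomial ha RtoC_mult.
  by rewrite !Cmult_assoc (Cmult_comm (c a)).
rewrite !hP Cmult_sumr; apply: eq_bigr => a /eqP ha.
by rewrite monomial_scal ha RtoC_mult !Cmult_assoc (Cmult_comm (c a)).
Qed.

(** * Reduction of the Helmholtz equation *)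

Definition sqnorm d (x : pt d) : R := \big[Rplus/0]_(i < d) (x i ^ 2).

Lemma sqnorm_ge0 d (x : pt d) : 0 <= sqnorm _ x.
Proof.
by apply: big_ind => [|u v|i _]; [lra | exact: Rplus_le_le_0_compat | exact: pow2_ge_0].
Qed.

Lemma sqnormD1 d (x : pt d) i :
  sqnorm _ x = x i ^ 2 + \big[Rplus/0]_(j < d | j != i) (x j ^ 2).
Proof. by rewrite /sqnorm (bigD1 i). Qed.

Lemma sqnorm_pos d (x : pt d) : x <> @origin d -> 0 < sqnorm _ x.
Proof.
move=> hx; case: (Rle_lt_or_eq_dec _ _ (sqnorm_ge0 _ x)) => // h0; case: hx.
apply: functional_extensionality => i.
have h : 0 <= \big[Rplus/0]_(j < d | j != i) (x j ^ 2).
  by apply: big_ind => [|u v|j _]; [lra | exact: Rplus_le_le_0_compat | exact: pow2_ge_0].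
move: h0 h; rewrite (sqnormD1 _ _ i) /origin; move: (\big[_/_]_(j < d | _) _) => B h0 h.
have : x i ^ 2 = 0 by have := pow2_ge_0 (x i); lra.
by rewrite /= Rmult_1_r => /Rmult_integral [].
Qed.

Lemma sqnorm_upd d (x : pt d) i t : sqnorm _ (upd x i t) = t ^ 2 + (sqnorm _ x - x i ^ 2).
Proof.
rewrite !(sqnormD1 _ _ i) upd_same.
have -> : \big[Rplus/0]_(j < d | j != i) (upd x i t j ^ 2)
    = \big[Rplus/0]_(j < d | j != i) (x j ^ 2).
  by apply: eq_bigr => j hj; rewrite upd_other.
by move: (\big[_/_]_(j < d | _) _) => B; ring.
Qed.

Lemma sqnorm_scal d (x : pt d) r : sqnorm _ (fun i => r * x i) = r ^ 2 * sqnorm _ x.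
Proof.
rewrite /sqnorm (big_morph (Rmult (r ^ 2)) (id1 := 0) (op1 := Rplus)) => //;
  [|exact: Rmult_plus_distr_l | exact: Rmult_0_r].
by apply: eq_bigr => i _; exact: Rpow_mult_distr.
Qed.

Lemma locally_sqnorm_upd d (x : pt d) i t : 0 < sqnorm _ (upd x i t) ->
  locally t (fun s => 0 < sqnorm _ (upd x i s)).
Proof.
move=> h.
have hc : continuous (fun s => sqnorm _ (upd x i s)) t.
  apply: (continuous_ext (fun s => s ^ 2 + (sqnorm _ x - x i ^ 2))).
    by move=> s; rewrite sqnorm_upd.
  by apply: (@ex_derive_continuous R_AbsRing R_NormedModule); auto_derive.
exact: hc _ (open_gt 0 _ h).
Qed.

Lemma is_partial2_unique d (f : pt d -> C) i x l l' :
  is_partial2 f i x l -> is_partial2 f i x l' -> l = l'.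
Proof.
move=> [g [hg hl]] [g' [hg' hl']].
apply: is_derive_RC_unique hl _.
apply: is_derive_ext_loc hl'.
apply: filter_imp (filter_and _ _ hg hg') => t [h h'].
exact: is_derive_RC_unique h' h.
Qed.

Lemma is_laplacian_unique d (f : pt d -> C) x l l' :
  is_laplacian f x l -> is_laplacian f x l' -> l = l'.
Proof.
move=> [h [hh ->]] [h' [hh' ->]]; apply: eq_bigr => i _.
exact: is_partial2_unique (hh i) (hh' i).
Qed.

Lemma is_derive_sqnorm_upd d (x : pt d) i (t kap : R) :
  is_derive (fun s => kap * sqnorm _ (upd x i s)) t (2 * kap * t).
Proof.
apply: (is_derive_ext (fun s => kap * (s ^ 2 + (sqnorm _ x - x i ^ 2)))).
  by move=> s; rewrite sqnorm_upd.
by auto_derive => //; ring.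
Qed.

Definition derives2 (g g1 g2 : R -> C) : Prop :=
  forall t, 0 < t -> is_derive_RC g t (g1 t) /\ is_derive_RC g1 t (g2 t).

Definition radial_operator (c : R) (g g1 g2 : R -> C) (t : R) : C :=
  (RtoC t * g2 t + RtoC c * g1 t + g t)%C.

(** Leibniz' rule with T = kap |x|^2, whose gradient is 2 kap x. The Laplacian of g(T) is 4 kap T
    g'' + 2 kap d g', the cross term is 4 kap n g' P by Euler's identity, and the term in the
    Laplacian of P is zero. Only g is missing from [radial_operator]; the term k^2 p restores it
    when k^2 = 4 kap. *)
Lemma is_laplacian_radial_harmonic d n (P : pt d -> C) kap g g1 g2 (u : pt d -> C) x :
  homogeneous_polynomial n P -> harmonic P -> 0 < kap -> derives2 g g1 g2 ->
  (forall y, 0 < sqnorm _ y -> u y = (g (kap * sqnorm _ y)%R * P y)%C) ->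
  0 < sqnorm _ x ->
  is_laplacian u x
   (RtoC (4 * kap) *
     (radial_operator (INR n + INR d / 2) g g1 g2 (kap * sqnorm _ x)
      - g (kap * sqnorm _ x)%R) * P x)%C.
Proof.
move=> hP hharm hk hg hu hx.
have [DP [hDP [heuler _]]] := homogeneous_polynomial_partials _ _ _ hP.
have [h [hh hsum]] := hharm x.
pose T y := kap * sqnorm d y.
have hT y : 0 < sqnorm _ y -> 0 < T y by exact: Rmult_lt_0_compat.
(* The first derivative hidden in [is_partial2] agrees with [DP i] near x, so the terms [h i], which
   sum to zero, are the derivatives of [DP i]. *)
have hD2 i : is_derive_RC (fun t => DP i (upd x i t)) (x i) (h i).
  have [q [hq hq2]] := hh i; apply: is_derive_ext_loc hq2.
  by apply: filter_imp hq => t hqt; apply: is_derive_RC_unique hqt _.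
have hTx i : kap * sqnorm d (upd x i (x i)) = T x by rewrite upd_id.
exists (fun i => g2 (T x) * (RtoC (2 * kap * x i) * RtoC (2 * kap * x i)) * P x
   + g1 (T x) * RtoC (2 * kap) * P x
   + RtoC 2 * (g1 (T x) * RtoC (2 * kap * x i) * DP i x) + g (T x) * h i)%C.
split=> [i|].
  pose G s := (RtoC (2 * kap * s) * g1 (T (upd x i s)) * P (upd x i s)
     + g (T (upd x i s)) * DP i (upd x i s))%C.
  exists G; split.
    have := locally_sqnorm_upd _ x i (x i); rewrite upd_id => /(_ hx).
    apply: filter_imp => t ht.
    apply: (is_derive_ext_loc (fun s => (g (T (upd x i s)) * P (upd x i s))%C)).
      by apply: filter_imp (locally_sqnorm_upd _ _ _ _ ht) => s hs; rewrite hu.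
    apply: is_derive_RC_mult (hDP i x t).
    apply: is_derive_RC_comp; first by case: (hg _ (hT _ ht)).
    exact: is_derive_sqnorm_upd.
  have [d1 d2] := hg _ (hT _ hx).
  have e1 : is_derive_RC (fun s => g1 (T (upd x i s))) (x i) (RtoC (2 * kap * x i) * g2 (T x))%C.
    by apply: (is_derive_RC_comp g1); [rewrite /T upd_id | exact: is_derive_sqnorm_upd].
  have e0 : is_derive_RC (fun s => g (T (upd x i s))) (x i) (RtoC (2 * kap * x i) * g1 (T x))%C.
    by apply: (is_derive_RC_comp g); [rewrite /T upd_id | exact: is_derive_sqnorm_upd].
  have el : is_derive_RC (fun s => RtoC (2 * kap * s)) (x i) (RtoC (2 * kap)).
    by apply: is_derive_RC_RtoC; auto_derive => //; ring.
  apply: is_derive_RC_eq (is_derive_RC_plus _ _ _ _ _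
    (is_derive_RC_mult _ _ _ _ _ (is_derive_RC_mult _ _ _ _ _ el e1) (hDP i x (x i)))
    (is_derive_RC_mult _ _ _ _ _ e0 (hD2 i))) _.
  by rewrite /= upd_id; ring.
rewrite !big_split /= -!Cmult_sumr -hsum Csum_const.
have s1 : \big[Cplus/RtoC 0]_(i < d) (g2 (T x) * (RtoC (2 * kap * x i) * RtoC (2 * kap * x i)) * P x)%C
  = (g2 (T x) * RtoC (4 * kap ^ 2 * sqnorm _ x) * P x)%C.
  have -> : (g2 (T x) * RtoC (4 * kap ^ 2 * sqnorm _ x) * P x
    = (g2 (T x) * P x * RtoC (4 * kap ^ 2)) * RtoC (sqnorm _ x))%C by rewrite !RtoC_mult; ring.
  rewrite /sqnorm RtoC_sum Cmult_sumr; apply: eq_bigr => i _.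
  rewrite -!RtoC_mult.
  have -> : 2 * kap * x i * (2 * kap * x i) = 4 * kap ^ 2 * x i ^ 2 by ring.
  by rewrite RtoC_mult; ring.
have s2 : \big[Cplus/RtoC 0]_(i < d) (g1 (T x) * RtoC (2 * kap * x i) * DP i x)%C
  = (g1 (T x) * RtoC (2 * kap) * (RtoC (INR n) * P x))%C.
  rewrite -heuler Cmult_sumr; apply: eq_bigr => i _.
  by rewrite RtoC_mult; ring.
rewrite s1 s2 /radial_operator -/(T x).
have -> : 4 * kap ^ 2 * sqnorm _ x = 4 * kap * T x by rewrite /T; ring.
have e4 : RtoC (4 * kap) = (RtoC 2 * RtoC 2 * RtoC kap)%C.
  by rewrite -!RtoC_mult; congr RtoC; ring.
rewrite (RtoC_mult (4 * kap) (T x)) e4 (RtoC_mult 2 kap) RtoC_plus (RtoC_mult (INR d) (/ 2)).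
have h2 : (RtoC 2 * RtoC (/ 2) = RtoC 1)%C by rewrite -RtoC_mult; congr RtoC; field.
transitivity (RtoC 2 * RtoC kap * (RtoC 2 * (RtoC (T x) * g2 (T x) + RtoC (INR n) * g1 (T x))
   + (RtoC 2 * RtoC (/ 2)) * RtoC (INR d) * g1 (T x)) * P x)%C; first by ring.
by rewrite h2; ring.
Qed.

Lemma derives2_mult f f1 f2 g g1 g2 : derives2 f f1 f2 -> derives2 g g1 g2 ->
  derives2 (fun t => f t * g t)%C (fun t => f1 t * g t + f t * g1 t)%C
    (fun t => f2 t * g t + f1 t * g1 t + (f1 t * g1 t + f t * g2 t))%C.
Proof.
move=> hf hg t ht; have [a b] := hf t ht; have [c e] := hg t ht.
split; first exact: is_derive_RC_mult.
by apply: is_derive_RC_plus; exact: is_derive_RC_mult.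
Qed.

(** The power (t / kap)^a. With t = kap r^2 it is r^(2a), so a = 1/2 recovers the radius and a =
    -n/2 gives r^(-n). *)
Definition scaled_power (kap a t : R) : R := exp (a * ln (t / kap)).

Lemma is_derive_scaled_power kap a t : 0 < kap -> 0 < t ->
  is_derive (scaled_power kap a) t (a / t * scaled_power kap a t).
Proof.
move=> hk ht; rewrite /scaled_power; auto_derive.
  by apply: Rdiv_lt_0_compat.
by rewrite /Rdiv; field; lra.
Qed.

Lemma is_derive_scaled_power1 kap a t : 0 < kap -> 0 < t ->
  is_derive (fun t => a / t * scaled_power kap a t) t
    (a * (a - 1) / t ^ 2 * scaled_power kap a t).
Proof.
move=> hk ht; rewrite /scaled_power; auto_derive.
  by split; [lra | split => //; apply: Rdiv_lt_0_compat].
by rewrite /Rdiv; field; lra.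
Qed.

Lemma derives2_scaled_power kap a : 0 < kap ->
  derives2 (fun t => RtoC (scaled_power kap a t)) (fun t => RtoC (a / t * scaled_power kap a t))
    (fun t => RtoC (a * (a - 1) / t ^ 2 * scaled_power kap a t)).
Proof.
move=> hk t ht; split; apply: is_derive_RC_RtoC.
  exact: is_derive_scaled_power.
exact: is_derive_scaled_power1.
Qed.

Lemma derives2_comp_scaled_power kap a f f1 f2 : 0 < kap -> derives2 f f1 f2 ->
  exists g1 g2, derives2 (fun t => f (scaled_power kap a t)) g1 g2.
Proof.
move=> hk hf.
pose q := scaled_power kap a; pose q1 t := a / t * scaled_power kap a t.
have hq t : 0 < q t by exact: exp_pos.
exists (fun t => RtoC (q1 t) * f1 (q t))%C, (fun t => RtoC (a * (a - 1) / t ^ 2 * q t) * f1 (q t)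
   + RtoC (q1 t) * (RtoC (q1 t) * f2 (q t)))%C => t ht.
have [d1 d2] := hf _ (hq t); have e := is_derive_scaled_power _ a _ hk ht.
split; first exact: is_derive_RC_comp.
apply: is_derive_RC_mult (is_derive_RC_comp _ _ _ _ _ d2 e).
by apply: is_derive_RC_RtoC; exact: is_derive_scaled_power1.
Qed.

(** The function g of the substitution R(r) = r^n g(kap r^2), solved for g. *)
Definition reduced_radial (n : nat) (kap : R) (Rad : R -> C) (t : R) : C :=
  (Rad (scaled_power kap (/ 2) t) * RtoC (scaled_power kap (- (INR n / 2)) t))%C.

Lemma reduced_radial_derives2 n kap Rad : 0 < kap -> C2_on_pos Rad ->
  exists g1 g2, derives2 (reduced_radial n kap Rad) g1 g2.
Proof.
move=> hk [f1 [f2 [h1 [h2 _]]]].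
have hf : derives2 Rad f1 f2 by move=> t ht; split; [exact: h1 | exact: h2].
have [q1 [q2 hq]] := derives2_comp_scaled_power _ (/ 2) _ _ _ hk hf.
do 2!eexists; exact: derives2_mult hq (derives2_scaled_power _ _ hk).
Qed.

Lemma scaled_power_half kap S : 0 < kap -> 0 < S -> scaled_power kap (/ 2) (kap * S) = sqrt S.
Proof.
move=> hk hS; rewrite -Rpower_sqrt // /scaled_power /Rpower.
by congr (exp (_ * ln _)); field; lra.
Qed.

Lemma scaled_power_half_opp n kap S : 0 < kap -> 0 < S ->
  scaled_power kap (- (INR n / 2)) (kap * S) = (/ sqrt S) ^ n.
Proof.
move=> hk hS; rewrite -Rpower_sqrt // -Rpower_Ropp -Rpower_pow; last exact: exp_pos.
rewrite Rpower_mult /scaled_power /Rpower.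
have -> : kap * S / kap = S by field; lra.
by congr exp; field.
Qed.

Lemma reduced_radialE n kap Rad r : 0 < kap -> 0 < r ->
  Rad r = (RtoC (r ^ n) * reduced_radial n kap Rad (kap * r ^ 2))%C.
Proof.
move=> hk hr; have hr2 : 0 < r ^ 2 by apply: pow_lt.
rewrite /reduced_radial scaled_power_half // scaled_power_half_opp // sqrt_pow2; last lra.
have e : (RtoC (r ^ n) * RtoC ((/ r) ^ n) = RtoC 1)%C.
  by rewrite -RtoC_mult -Rpow_mult_distr Rinv_r ?pow1 //; lra.
by rewrite (Cmult_comm (Rad r)) Cmult_assoc e Cmult_1_l.
Qed.

Lemma radial_times_angularE d n kap (P Y : pt d -> C) Rad y :
  homogeneous_polynomial n P -> (forall x, enorm x = 1 -> Y x = P x) -> 0 < kap ->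
  0 < sqnorm _ y ->
  radial_times_angular Rad Y y = (reduced_radial n kap Rad (kap * sqnorm _ y) * P y)%C.
Proof.
move=> hP hY hk hy.
have [_ [_ [_ hscal]]] := homogeneous_polynomial_partials _ _ _ hP.
rewrite /radial_times_angular /enorm -/(sqnorm _ y).
have hs := sqrt_lt_R0 _ hy.
have -> : (fun i => (y i / sqrt (sqnorm _ y))%R) = (fun i => / sqrt (sqnorm _ y) * y i)%R.
  by apply: functional_extensionality => i; rewrite Rmult_comm.
rewrite hY; last first.
  rewrite /enorm -/(sqnorm _ _) sqnorm_scal pow_inv pow2_sqrt; last lra.
  by rewrite Rinv_l ?sqrt_1 //; lra.
by rewrite hscal /reduced_radial scaled_power_half // scaled_power_half_opp // Cmult_assoc.
Qed.

(** Off the origin, (Laplacian + k^2) p is k^2 P(x) times the radial operator at kap |x|^2. A single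
    direction where P is nonzero suffices for the converse, since its ray meets every value t >
    0. *)
Lemma helmholtz_iff_radial_equation d n k (Y : pt d -> C) Rad g1 g2 :
  0 < k -> spherical_harmonic n Y -> nonzero_on_sphere Y ->
  derives2 (reduced_radial n (k ^ 2 / 4) Rad) g1 g2 ->
  helmholtz_off_origin k (radial_times_angular Rad Y) <->
  forall t, 0 < t ->
    radial_operator (INR n + INR d / 2) (reduced_radial n (k ^ 2 / 4) Rad) g1 g2 t = RtoC 0.
Proof.
move=> hk [P [hP [hharm hYP]]] [x0 [hx0 hY0]] hg.
set kap := k ^ 2 / 4 in hg *; set g := reduced_radial n kap Rad in hg *.
have hkap : 0 < kap by rewrite /kap; have := pow_lt k 2 hk; lra.
have hu y : 0 < sqnorm _ y -> radial_times_angular Rad Y y = (g (kap * sqnorm _ y)%R * P y)%C.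
  by move=> hy; exact: radial_times_angularE hP hYP hkap hy.
have hlap x hx := is_laplacian_radial_harmonic _ _ _ _ _ _ _ _ x hP hharm hkap hg hu hx.
have hk2 : RtoC (k ^ 2) = RtoC (4 * kap) by congr RtoC; rewrite /kap; field.
split=> [hH t ht|hR x /sqnorm_pos hx]; last first.
  eexists; split; first exact: hlap hx.
  rewrite hR ?hu //; last exact: Rmult_lt_0_compat.
  by rewrite hk2; ring.
have hx01 : sqnorm _ x0 = 1.
  by rewrite -(sqrt_sqrt (sqnorm _ x0)) ?[sqrt _]hx0 ?Rmult_1_r //; exact: sqnorm_ge0.
(* The point r x0 on the ray through x0 is the one with kap |x|^2 = t. *)
pose r := sqrt (t / kap).
have htk : 0 < t / kap by apply: Rdiv_lt_0_compat.
have hr : 0 < r by exact: sqrt_lt_R0.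
pose x : pt d := fun i => r * x0 i.
have hx : sqnorm _ x = t / kap by rewrite sqnorm_scal hx01 Rmult_1_r /r pow2_sqrt; lra.
have hxp : 0 < sqnorm _ x by rewrite hx.
have hTx : kap * sqnorm _ x = t by rewrite hx; field; lra.
have hx0' : x <> @origin d.
  move=> e; move: hxp; rewrite /sqnorm big1; first lra.
  by move=> i _; rewrite e /origin /= Rmult_0_l.
have hPx : P x <> RtoC 0.
  have [_ [_ [_ hscal]]] := homogeneous_polynomial_partials _ _ _ hP.
  rewrite /x hscal -hYP //; apply: Cmult_neq_0 => //.
  by move=> /RtoC_inj; apply: pow_nonzero; lra.
have [l [hl he]] := hH x hx0'.
move: he; rewrite (is_laplacian_unique _ _ _ _ _ hl (hlap x hxp)) hu // hTx hk2.
set L := radial_operator _ _ _ _ _.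
have -> : (RtoC (4 * kap) * (L - g t) * P x + RtoC (4 * kap) * (g t * P x) =
  RtoC (4 * kap) * P x * L)%C by ring.
move=> e.
case: (Ceq_dec L (RtoC 0)) => // hL.
exfalso; move: e; apply: Cmult_neq_0 => //; apply: Cmult_neq_0 => //.
by move=> /RtoC_inj; lra.
Qed.

(** * Solutions of the radial equation *)

(** With e = d/2 - 1 the division in [Jdn] and [Ndn] leaves exactly the integer power z^n that
    [reduced_radial] splits off. *)
Lemma bessel_prefactor n (e z : R) : 0 < z ->
  Rpower (z / 2) (INR n + e) / Rpower z e = z ^ n * Rpower (/ 2) (INR n + e).
Proof.
move=> hz; rewrite /Rdiv -Rpower_mult_distr //; last lra.
rewrite {1}Rpower_plus Rpower_pow //.
have : Rpower z e <> 0 by have := exp_pos (e * ln z); rewrite /Rpower; lra.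
by move=> h; field.
Qed.

(** The constant by which [Jdn] and [Ndn] at k r differ from r^n times the two basic solutions at (k
    r / 2)^2. Being common to both and nonzero, it is absorbed into A and B. *)
Definition wave_constant d n k : R :=
  Rpower (2 * PI) (INR d / 2) * (k ^ n * Rpower (/ 2) (INR n + INR d / 2 - 1)).

Lemma wave_constant_neq0 d n k : 0 < k -> wave_constant d n k <> 0.
Proof.
move=> hk.
have h1 : 0 < Rpower (2 * PI) (INR d / 2) by exact: exp_pos.
have h2 : 0 < Rpower (/ 2) (INR n + INR d / 2 - 1) by exact: exp_pos.
have h3 := pow_lt k n hk.
by apply: Rgt_not_eq; do !apply: Rmult_lt_0_compat.
Qed.

Lemma wave_radial_part d n k r (b w : R -> R) : 0 < k -> 0 < r ->
  (forall z, 0 < z -> b z = Rpower (z / 2) (INR n + INR d / 2 - 1) * w ((z / 2) ^ 2)) ->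
  Rpower (2 * PI) (INR d / 2) * (b (k * r) / Rpower (k * r) (INR d / 2 - 1))
  = r ^ n * (wave_constant d n k * w (k ^ 2 / 4 * r ^ 2)).
Proof.
move=> hk hr hb; have hz : 0 < k * r by exact: Rmult_lt_0_compat.
rewrite hb //.
have -> : (k * r / 2) ^ 2 = k ^ 2 / 4 * r ^ 2 by field.
have := bessel_prefactor n (INR d / 2 - 1) _ hz.
have -> : INR n + (INR d / 2 - 1) = INR n + INR d / 2 - 1 by ring.
set a := Rpower (k * r / 2) _; set v := w _; set p := Rpower (k * r) _ => h.
have -> : a * v / p = a / p * v by rewrite /Rdiv; ring.
by rewrite h /wave_constant Rpow_mult_distr; ring.
Qed.

Lemma is_derive_eq_pos (f g : R -> R) t l : 0 < t -> (forall s, 0 < s -> f s = g s) ->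
  is_derive f t l -> is_derive g t l.
Proof.
move=> ht hfg; apply: is_derive_ext_loc.
exact: filter_imp hfg (open_gt 0 t ht).
Qed.

(** Functions equal on the open half-line have the same derivatives there, so the equation known for
    y passes to the prescribed derivatives of f. *)
Lemma clifford_equation_transfer c y y1 (f f1 f2 : R -> R) :
  clifford_equation c (fun _ => 0) y y1 -> (forall t, 0 < t -> y t = f t) ->
  (forall t, 0 < t -> is_derive f t (f1 t) /\ is_derive f1 t (f2 t)) ->
  forall t, 0 < t -> t * f2 t + c * f1 t + f t = 0.
Proof.
move=> hy hyf hf.
have hy1 t : 0 < t -> y1 t = f1 t.
  move=> ht; have [h _] := hy t ht; have [h' _] := hf t ht.
  have := is_derive_unique _ _ _ (is_derive_eq_pos _ _ _ _ ht hyf h).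
  by rewrite (is_derive_unique _ _ _ h').
move=> t ht; have [_ [y2 [h2 <-]]] := hy t ht; have [_ h2'] := hf t ht.
have := is_derive_unique _ _ _ (is_derive_eq_pos _ _ _ _ ht hy1 h2).
by rewrite (is_derive_unique _ _ _ h2') => ->; rewrite hy1 // hyf.
Qed.

(** The equation and both basic solutions are real, so real and imaginary parts separate: the real
    coefficients of the two parts assemble into A and B, and conversely each part is a real
    combination. *)
Lemma radial_equation_span c g g1 g2 u u1 w w1 t0 : derives2 g g1 g2 ->
  clifford_equation c (fun _ => 0) u u1 -> clifford_equation c (fun _ => 0) w w1 ->
  0 < t0 -> u t0 * w1 t0 - u1 t0 * w t0 <> 0 ->
  (forall t, 0 < t -> radial_operator c g g1 g2 t = RtoC 0) <->
  exists A B : C, forall t, 0 < t -> g t = (A * RtoC (u t) + B * RtoC (w t))%C.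
Proof.
move=> hg hu hw ht0 hW.
have hgf t : 0 < t -> is_derive (fun s => fst (g s)) t (fst (g1 t)) /\
    is_derive (fun s => fst (g1 s)) t (fst (g2 t)).
  by move=> ht; have [h h'] := hg t ht; split; exact: is_derive_RC_fst.
have hgs t : 0 < t -> is_derive (fun s => snd (g s)) t (snd (g1 t)) /\
    is_derive (fun s => snd (g1 s)) t (snd (g2 t)).
  by move=> ht; have [h h'] := hg t ht; split; exact: is_derive_RC_snd.
have opf t : fst (radial_operator c g g1 g2 t)
    = t * fst (g2 t) + c * fst (g1 t) + fst (g t) by rewrite /=; ring.
have ops t : snd (radial_operator c g g1 g2 t)
    = t * snd (g2 t) + c * snd (g1 t) + snd (g t) by rewrite /=; ring.
split=> [h|[A [B h]] t ht].
  have [|a1 [b1 h1]] := clifford_equation_span _ _ _ _ _ _ hu hw ht0 hW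
    (fun s => fst (g s)) (fun s => fst (g1 s)).
    move=> t ht; have [d1 d2] := hgf t ht; split => //; exists (fst (g2 t)); split => //.
    by rewrite -opf h.
  have [|a2 [b2 h2]] := clifford_equation_span _ _ _ _ _ _ hu hw ht0 hW
    (fun s => snd (g s)) (fun s => snd (g1 s)).
    move=> t ht; have [d1 d2] := hgs t ht; split => //; exists (snd (g2 t)); split => //.
    by rewrite -ops h.
  exists (a1, a2), (b1, b2) => t ht.
  rewrite (surjective_pairing (g t)) h1 // h2 //.
  by rewrite /Cplus /Cmult /=; congr pair; ring.
have hcomb a b : clifford_equation c (fun _ => 0) (fun s => a * u s + b * w s)
    (fun s => a * u1 s + b * w1 s).
  apply: clifford_equation_ext (clifford_equation_plus _ _ _ _ _ _ _
    (clifford_equation_scal _ _ _ _ a hu) (clifford_equation_scal _ _ _ _ b hw)).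
  by move=> s _ /=; ring.
rewrite (surjective_pairing (radial_operator _ _ _ _ _)) opf ops.
rewrite (clifford_equation_transfer _ _ _ _ _ _ (hcomb (fst A) (fst B)) _ hgf) //; last first.
  by move=> s hs; rewrite h //=; ring.
rewrite (clifford_equation_transfer _ _ _ _ _ _ (hcomb (snd A) (snd B)) _ hgs) //.
by move=> s hs; rewrite h //=; ring.
Qed.

Theorem mainTheorem1 (d n : nat) (hd : (1 <= d)%N) (k : R) (hk : 0 < k)
  (Y : pt d -> C) (hY : spherical_harmonic n Y) (hY0 : nonzero_on_sphere Y)
  (Rad : R -> C) (hRad : C2_on_pos Rad) :
  helmholtz_off_origin k (radial_times_angular Rad Y) <->
  exists A B : C, forall r : R, 0 < r ->
    Rad r = (A * RtoC (Jdn d n (k * r)) + B * RtoC (Ndn d n (k * r)))%C.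
Proof.
have hkap : 0 < k ^ 2 / 4 by have := pow_lt k 2 hk; lra.
have [g1 [g2 hg]] := reduced_radial_derives2 n _ _ hkap hRad.
rewrite (helmholtz_iff_radial_equation _ _ _ _ _ _ _ hk hY hY0 hg).
have [w [[u1 [w1 [hu [hw [t0 [ht0 hW]]]]]] hN]] := besselN_fundamental_system d n hd.
have hnu : INR n + INR d / 2 - 1 + 1 = INR n + INR d / 2 by ring.
rewrite hnu in hu hw.
rewrite (radial_equation_span _ _ _ _ _ _ _ _ _ hg hu hw ht0 hW).
have hc := wave_constant_neq0 d n k hk.
have hJr r : 0 < r -> Jdn d n (k * r) =
    r ^ n * (wave_constant d n k * clifford (INR n + INR d / 2 - 1) (k ^ 2 / 4 * r ^ 2)).
  by move=> hr; apply: (wave_radial_part d n k r (besselJ _)).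
have hNr r : 0 < r -> Ndn d n (k * r) =
    r ^ n * (wave_constant d n k * w (k ^ 2 / 4 * r ^ 2)).
  by move=> hr; apply: (wave_radial_part d n k r (besselN _)).
set kap := k ^ 2 / 4 in hkap hg hJr hNr *.
move: (wave_constant d n k) hc hJr hNr => q hc hJr hNr.
have hc' : RtoC q <> RtoC 0 by move/RtoC_inj.
split=> [[A [B h]]|[A [B h]]].
  exists (A / RtoC q)%C, (B / RtoC q)%C => r hr.
  have hr2 : 0 < kap * r ^ 2 by apply: Rmult_lt_0_compat => //; exact: pow_lt.
  rewrite (reduced_radialE n kap Rad r hkap hr) h // hJr // hNr // !RtoC_mult.
  by field; exact: hc'.
(* The hypothesis is read at r = sqrt (t / kap), where kap r^2 = t; the common factor r^n is nonzero
   and is cancelled. *)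
exists (A * RtoC q)%C, (B * RtoC q)%C => t ht.
have htk : 0 < t / kap by apply: Rdiv_lt_0_compat.
have hr := sqrt_lt_R0 _ htk.
have e : kap * sqrt (t / kap) ^ 2 = t by rewrite pow2_sqrt; [field|]; lra.
have := h _ hr; rewrite (reduced_radialE n kap Rad _ hkap hr) hJr // hNr // !e.
have hrn : RtoC (sqrt (t / kap) ^ n) <> RtoC 0.
  by move=> /RtoC_inj; apply: pow_nonzero; lra.
rewrite !RtoC_mult; set z := RtoC (sqrt _ ^ n) => e2.
have -> : reduced_radial n kap Rad t = (/ z * (z * reduced_radial n kap Rad t))%C.
  by field; exact: hrn.
by rewrite e2; field; exact: hrn.
Qed.
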